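(* Let $\Gamma$ be a nontrivial group, $K=\bigoplus_{\mathbf{Q}_2}\Gamma$, $\overline K=\prod_{\mathbf{Q}_2}\Gamma$, and $G=K\rtimes V$ the untwisted permutational restricted wreath product (with $V$ acting by $(v\cdot a)(x)=a(v^{-1}x)$), viewed inside $\overline G=\overline K\rtimes V$. Let $Q=\big(Z\Gamma\times N_{\overline K}(G)/Z\Gamma\big)\rtimes_\sigma\big(\mathrm{Stab}_N(\mathbf{Q}_2)\times\mathrm{Aut}(\Gamma)\big)$ with $\sigma(\varphi,\beta)(\zeta,f)=(\beta(\zeta),\ \overline\beta(f)^\varphi\cdot\beta(\zeta)^{\mu_\varphi})$. Then the map $\Xi:Q\to\mathrm{Aut}(G)$, $(\zeta,f,\varphi,\beta)\mapsto E_\zeta\circ\mathrm{ad}(f)\circ A_{\varphi,\beta}$ is a surjective group morphism whose kernel is $\{(e,\overline g,e,\mathrm{ad}(g^{-1})):\ g\in\Gamma\}$, where $\overline g$ is the class of the constant map $\mathbf{Q}_2\to\Gamma$ with value $g$ and $\mathrm{ad}(g^{-1})(h)=g^{-1}hg$.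
   Context: Cantor space $\mathfrak C=\{0,1\}^{\mathbf N}$; for a finite word $m$, $C_m=\{m\cdot x\}$. Thompson's group $V$: homeomorphisms $v$ of $\mathfrak C$ such that for two partitions $\mathfrak C=\bigsqcup_k C_{m_k}=\bigsqcup_k C_{m'_k}$, $v(m_kx)=m'_kx$; slope $v'(x)=2^{|m_k|-|m'_k|}$ for $x\in C_{m_k}$ (chain rule holds). $\mathbf{Q}_2\subset\mathfrak C$: eventually-zero sequences, identified with dyadic rationals in $[0,1)$ via $x\mapsto\sum_{n\ge1}x_n2^{-n}$; $0$ is the zero sequence. $\nu$ is the dyadic valuation: $\nu(0)=0$ and $\nu(2^k p/q)=k$ for $p,q$ odd. $N_{H(\mathfrak C)}(V)=\{\varphi\in\mathrm{Homeo}(\mathfrak C):\varphi V\varphi^{-1}=V\}$ and $\mathrm{Stab}_N(\mathbf{Q}_2)=\{\varphi\in N_{H(\mathfrak C)}(V):\varphi(\mathbf{Q}_2)=\mathbf{Q}_2\}$. Notation: for $f:\mathbf{Q}_2\to\Gamma$, $f^v(x)=f(v^{-1}x)$, $f^\varphi(x)=f(\varphi^{-1}x)$, $\overline\beta(f)(x)=\beta(f(x))$; $\mathrm{ad}_\varphi(v)=\varphi v\varphi^{-1}$. $Z\Gamma$ is the centre of $\Gamma$, also identified with constant $Z\Gamma$-valued maps in $\overline K$. $N_{\overline K}(G)=\{f\in\overline K: fGf^{-1}=G\}$ (conjugation inside $\overline G$). Automorphisms of $G$: $A_{\varphi,\beta}(av)=\overline\beta(a)^\varphi\,\mathrm{ad}_\varphi(v)$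 for $(\varphi,\beta)\in\mathrm{Stab}_N(\mathbf{Q}_2)\times\mathrm{Aut}(\Gamma)$; $\mathrm{ad}(f)(av)=favf^{-1}$ for $f\in N_{\overline K}(G)$ (factoring through $N_{\overline K}(G)/Z\Gamma$); $E_\zeta(av)=a\cdot\zeta^{p_v}\cdot v$ for $\zeta\in Z\Gamma$, where $p_v(x)=\log_2(v'(v^{-1}x))-\nu(x)+\nu(v^{-1}x)$ and $\zeta^{p_v}(x)=\zeta^{p_v(x)}$. For $\varphi\in\mathrm{Stab}_N(\mathbf{Q}_2)$, $\mu_\varphi:\mathbf{Q}_2\to\mathbf Z$ is $\mu_\varphi(x)=\log_2\big((\varphi^{-1}v\varphi)'(\varphi^{-1}0)\big)-\log_2(v'(0))-\nu(\varphi^{-1}x)+\nu(x)$ for any $v\in V$ with $v0=x$ (independent of $v$), and $\beta(\zeta)^{\mu_\varphi}(x)=\beta(\zeta)^{\mu_\varphi(x)}$. $\sigma$ is an action by automorphisms of $\mathrm{Stab}_N(\mathbf{Q}_2)\times\mathrm{Aut}(\Gamma)$ on $Z\Gamma\times N_{\overline K}(G)/Z\Gamma$. *)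

(* Defs.v *)
From Stdlib Require Import ZArith List Arith ClassicalEpsilon.
Import ListNotations.
Open Scope Z_scope.

Definition Cantor := nat -> bool.
Definition zeroC : Cantor := fun _ => false.

Definition prefix (m : list bool) (x : Cantor) : Prop :=
  forall i, (i < length m)%nat -> x i = nth i m false.

Definition app_word (m : list bool) (x : Cantor) : Cantor :=
  fun n => if (n <? length m)%nat then nth n m false else x (n - length m)%nat.

Definition is_partition (ms : list (list bool)) : Prop :=
  forall x, exists! k, (k < length ms)%nat /\ prefix (nth k ms nil) x.

Definition isVrep (v : Cantor -> Cantor) (ps : list (list bool * list bool)) : Prop :=
  is_partition (map fst ps) /\ is_partition (map snd ps) /\
  forall k, (k < length ps)%nat -> forall x,
    v (app_word (fst (nth k ps (nil, nil))) x) = app_word (snd (nth k ps (nil, nil))) x.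

Definition isV (v : Cantor -> Cantor) : Prop := exists ps, isVrep v ps.

(* log_2 of the slope v'(x) = 2^{|m_k| - |m'_k|} for x in C_{m_k} *)
Definition slope_rel (v : Cantor -> Cantor) (x : Cantor) (n : Z) : Prop :=
  exists ps, isVrep v ps /\ exists k, (k < length ps)%nat /\
    prefix (fst (nth k ps (nil, nil))) x /\
    n = Z.of_nat (length (fst (nth k ps (nil, nil))))
        - Z.of_nat (length (snd (nth k ps (nil, nil)))).
Definition lslope (v : Cantor -> Cantor) (x : Cantor) : Z :=
  epsilon (inhabits 0) (slope_rel v x).

Definition finv (f : Cantor -> Cantor) (x : Cantor) : Cantor :=
  epsilon (inhabits x) (fun y => f y = x).

Definition inQ2 (x : Cantor) : Prop := exists N, forall n, (N <= n)%nat -> x n = false.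

(* dyadic valuation: x = sum_{n>=1} x_n 2^{-n}; here x i is the digit x_{i+1}.
   nu(0) = 0; if the last nonzero digit is x_{i+1} then x = odd/2^{i+1}, nu = -(i+1). *)
Definition nu_rel (x : Cantor) (k : Z) : Prop :=
  ((forall n, x n = false) /\ k = 0) \/
  (exists i, x i = true /\ (forall j, (i < j)%nat -> x j = false) /\ k = - Z.of_nat (S i)).
Definition nu (x : Cantor) : Z := epsilon (inhabits 0) (nu_rel x).

Definition p_v (v : Cantor -> Cantor) (x : Cantor) : Z :=
  lslope v (finv v x) - nu x + nu (finv v x).

Definition mu (phi : Cantor -> Cantor) (x : Cantor) : Z :=
  let v := epsilon (inhabits (fun y : Cantor => y)) (fun v => isV v /\ v zeroC = x) in
  lslope (fun y => finv phi (v (phi y))) (finv phi zeroC) - lslope v zeroC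
  - nu (finv phi x) + nu x.

Definition contC (f : Cantor -> Cantor) : Prop :=
  forall x n, exists m, forall y, (forall i, (i < m)%nat -> y i = x i) ->
    forall i, (i < n)%nat -> f y i = f x i.
Definition homeoC (f : Cantor -> Cantor) : Prop :=
  contC f /\ exists g, (forall x, g (f x) = x) /\ (forall x, f (g x) = x) /\ contC g.

Definition inStab (phi : Cantor -> Cantor) : Prop :=
  homeoC phi /\
  (forall v, isV v -> isV (fun x => phi (v (finv phi x)))) /\
  (forall w, isV w -> exists v, isV v /\ forall x, w x = phi (v (finv phi x))) /\
  (forall x, inQ2 x <-> inQ2 (phi x)).

Record Grp := { car :> Type; gmul : car -> car -> car; ginv : car -> car; gone : car }.

Definition group_axioms (Gm : Grp) : Prop :=
  (forall a b c, gmul Gm a (gmul Gm b c) = gmul Gm (gmul Gm a b) c) /\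
  (forall a, gmul Gm (gone Gm) a = a) /\ (forall a, gmul Gm a (gone Gm) = a) /\
  (forall a, gmul Gm (ginv Gm a) a = gone Gm) /\ (forall a, gmul Gm a (ginv Gm a) = gone Gm).

Section Wreath.
Variable Gm : Grp.
Local Notation T := (car Gm).
Local Notation mul := (gmul Gm).
Local Notation inv := (ginv Gm).
Local Notation e := (gone Gm).

Definition isAutGamma (b : T -> T) : Prop :=
  (forall x y, b (mul x y) = mul (b x) (b y)) /\
  (forall x y, b x = b y -> x = y) /\ (forall y, exists x, b x = y).

Definition central (c : T) : Prop := forall h, mul c h = mul h c.

Definition zpow (g : T) (k : Z) : T :=
  match k with
  | Z0 => e
  | Zpos p => Nat.iter (Pos.to_nat p) (mul g) e
  | Zneg p => Nat.iter (Pos.to_nat p) (mul (inv g)) e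
  end.

(* maps Q_2 -> Gamma are represented by maps Cantor -> Gamma equal to e off Q_2 *)
Definition restrictQ2 (h : Cantor -> T) : Cantor -> T :=
  fun x => if excluded_middle_informative (inQ2 x) then h x else e.
Definition inKbar (a : Cantor -> T) : Prop := forall x, ~ inQ2 x -> a x = e.
Definition inK (a : Cantor -> T) : Prop :=
  inKbar a /\ exists l : list Cantor, forall x, a x <> e -> In x l.
Definition pmul (a b : Cantor -> T) : Cantor -> T := fun x => mul (a x) (b x).
Definition constQ (g : T) : Cantor -> T := restrictQ2 (fun _ => g).

(* Gbar = Kbar x| V, element a v represented as the pair (a, v) *)
Definition GbarT : Type := ((Cantor -> T) * (Cantor -> Cantor))%type.
Definition Gmul (g h : GbarT) : GbarT :=
  (fun x => mul (fst g x) (fst h (finv (snd g) x)), fun x => snd g (snd h x)).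
Definition Ginv (g : GbarT) : GbarT :=
  (fun y => inv (fst g (snd g y)), finv (snd g)).
Definition inG (g : GbarT) : Prop := inK (fst g) /\ isV (snd g).

Definition isAutG (al : GbarT -> GbarT) : Prop :=
  (forall g, inG g -> inG (al g)) /\
  (forall g h, inG g -> inG h -> al (Gmul g h) = Gmul (al g) (al h)) /\
  (forall g h, inG g -> inG h -> al g = al h -> g = h) /\
  (forall h, inG h -> exists g, inG g /\ al g = h).

Definition ad (f : Cantor -> T) (g : GbarT) : GbarT :=
  Gmul (Gmul (f, fun x => x) g) (Ginv (f, fun x => x)).

Definition inNKG (f : Cantor -> T) : Prop :=
  inKbar f /\ (forall g, inG g -> inG (ad f g)) /\
  (forall h, inG h -> exists g, inG g /\ ad f g = h).

Definition Aphib (phi : Cantor -> Cantor) (b : T -> T) (g : GbarT) : GbarT :=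
  (fun x => b (fst g (finv phi x)), fun x => phi (snd g (finv phi x))).

Definition Ez (z : T) (g : GbarT) : GbarT :=
  (pmul (fst g) (restrictQ2 (fun x => zpow z (p_v (snd g) x))), snd g).

Definition QT : Type := (T * (Cantor -> T) * (Cantor -> Cantor) * (T -> T))%type.

Definition inQ (q : QT) : Prop :=
  let '(z, f, phi, b) := q in central z /\ inNKG f /\ inStab phi /\ isAutGamma b.

(* equality in Q (f taken modulo the constant Z Gamma-valued maps) *)
Definition Qeq (q q' : QT) : Prop :=
  let '(z, f, phi, b) := q in let '(z', f', phi', b') := q' in
  z = z' /\ (exists c, central c /\ f' = pmul f (constQ c)) /\
  (forall x, phi x = phi' x) /\ (forall h, b h = b' h).

Definition sigma_f (phi : Cantor -> Cantor) (b : T -> T) (z : T) (f : Cantor -> T) : Cantor -> T :=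
  pmul (fun x => b (f (finv phi x))) (restrictQ2 (fun x => zpow (b z) (mu phi x))).

(* semidirect product law: (n1,h1)(n2,h2) = (n1 . sigma(h1)(n2), h1 h2) *)
Definition Qmul (q1 q2 : QT) : QT :=
  let '(z1, f1, phi1, b1) := q1 in let '(z2, f2, phi2, b2) := q2 in
  (mul z1 (b1 z2), pmul f1 (sigma_f phi1 b1 z2 f2),
   fun x => phi1 (phi2 x), fun h => b1 (b2 h)).

Definition Xi (q : QT) (g : GbarT) : GbarT :=
  let '(z, f, phi, b) := q in Ez z (ad f (Aphib phi b g)).

Definition kerElt (g0 : T) : QT :=
  (e, constQ g0, fun x => x, fun h => mul (inv g0) (mul h g0)).

End Wreath.

(* Main.v *)
Require Import Defs.
From Stdlib Require Import ZArith List ClassicalEpsilon FunctionalExtensionality Lia Permutation ssreflect.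
Import ListNotations.
Local Open Scope general_if_scope.
Local Open Scope nat_scope.

(* Only surjectivity is deep.  Given an automorphism [al] of G:

   - The images in V of the factors [al(Gamma_x)] commute pairwise and are permuted by
     conjugation.  Commutators of 3-cycles of cones show that such subgroups would have
     disjoint supports, and a swap of two cones mixing two supports gives a contradiction
     unless they are trivial; so [al] preserves K.
   - The support of [al(delta_x g)] is finite and equivariant under the induced automorphism
     [psi] of V; high transitivity of V on the dyadic points makes it a single point
     [phi(x)], independent of [g].
   - Clopen sets are the supports of involutions of V, so [phi] is uniformly continuous on
     the dyadic points and extends to a homeomorphism inducing [psi]; this replaces the
     appeal to Rubin's theorem.
   - After composing with [A_(phi^-1)], [al] is given by a cocycle [v |-> c_v].  Its value at 0
     on the stabiliser of 0 is central, and since V is perfect (it is generated by swaps of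
     cones, each of which is the product of two conjugate involutions) it is [zeta] to the
     power of the log-slope.  Transporting by elements [v_x] with [v_x 0 = x] produces [f].

   The morphism property rests on the invariance of slopes at fixed points under the
   normaliser: the germ group at 0 is infinite cyclic, and contractions stay contractions. *)

(* The formula for [p_v] comes from coinduction: a cocycle of V with values in maps on the dyadic
   points is determined, up to the coboundary of a map [f], by its values at 0 on the stabiliser of
   0, where every homomorphism with commuting values is a constant raised to the log-slope. The
   log-slope at [v^-1 x] alone already extends that character to a cocycle on V, but it has infinite
   support; correcting it by the coboundary of [nu] leaves finitely many nonzero values for each
   element, so [E_zeta] stays inside G. Neither ingredient is preserved pointwise by the normaliser:
   [mu] measures the discrepancy, and it is independent of the chosen representative because slopes
   at fixed points are invariant. Membership in V is handled as bijectivity plus local affinity, so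
   that partition tables are needed only at the interface. Inverses and slopes are values of
   [epsilon], which is why the group laws carry hypotheses such as [bij], [isV] or [inG]. *)
Local Infix "^^" := app_word (at level 30, right associativity).

(** * Words, cones and prefixes *)

Lemma app_word_lt m x i : i < length m -> (m ^^ x) i = nth i m false.
Proof. rewrite /app_word => H. by case: (Nat.ltb_spec i (length m)); [|lia]. Qed.

Lemma app_word_ge m x i : length m <= i -> (m ^^ x) i = x (i - length m).
Proof. rewrite /app_word => H. by case: (Nat.ltb_spec i (length m)); [lia|]. Qed.

Lemma app_word_shift m x i : (m ^^ x) (length m + i) = x i.
Proof. rewrite app_word_ge; [lia|]. f_equal; lia. Qed.

Lemma app_word_nil x : [] ^^ x = x.
Proof. extensionality i. rewrite app_word_ge /=; [lia|]. f_equal; lia. Qed.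

Lemma app_word_app m n x : (m ++ n) ^^ x = m ^^ n ^^ x.
Proof.
extensionality i. have L := length_app m n.
case: (Nat.lt_ge_cases i (length m)) => H.
  by rewrite !app_word_lt ?L ?app_nth1; try lia.
rewrite (app_word_ge m) //. case: (Nat.lt_ge_cases i (length (m ++ n))) => H'.
  by rewrite !app_word_lt ?app_nth2; try lia.
rewrite !app_word_ge; try lia. f_equal; lia.
Qed.

Lemma app_word_inj m x y : m ^^ x = m ^^ y -> x = y.
Proof. move=> H. extensionality i. by rewrite -(app_word_shift m x) H app_word_shift. Qed.

Definition pre (x : Cantor) n := map x (seq 0 n).
Definition drop n (x : Cantor) : Cantor := fun i => x (n + i).

Lemma pre_length x n : length (pre x n) = n.
Proof. by rewrite length_map length_seq. Qed.

Lemma nth_pre x n i : i < n -> nth i (pre x n) false = x i.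
Proof.
move=> H. rewrite (nth_indep _ false (x 0)) ?pre_length //.
by rewrite /pre map_nth seq_nth.
Qed.

Lemma app_pre_drop x n : pre x n ^^ drop n x = x.
Proof.
extensionality i. case: (Nat.lt_ge_cases i n) => H.
  by rewrite app_word_lt ?pre_length ?nth_pre.
rewrite app_word_ge pre_length // /drop. f_equal; lia.
Qed.

Lemma pre_app m x : pre (m ^^ x) (length m) = m.
Proof.
apply: (nth_ext _ _ false false); rewrite pre_length // => i H.
by rewrite nth_pre // app_word_lt.
Qed.

Lemma drop_app m x : drop (length m) (m ^^ x) = x.
Proof. extensionality i. exact: app_word_shift. Qed.

Lemma pre_ext x y n : (forall i, i < n -> x i = y i) -> pre x n = pre y n.
Proof. move=> H. apply: map_ext_in => i /in_seq Hi. apply: H; lia. Qed.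

Lemma pre_eq x y n i : pre x n = pre y n -> i < n -> x i = y i.
Proof. move=> E H. by rewrite -(nth_pre x n i H) E nth_pre. Qed.

Lemma pre_add x n k : pre x (n + k) = pre x n ++ pre (drop n x) k.
Proof.
rewrite /pre seq_app map_app /=. f_equal.
apply: (nth_ext _ _ (x 0) (drop n x 0)); rewrite !length_map !length_seq // => i Hi.
rewrite !map_nth. rewrite /drop -[nth i _ 0]/(nth i _ 0).
by rewrite !seq_nth.
Qed.

Lemma prefix_pre m x : prefix m x <-> pre x (length m) = m.
Proof.
split=> [H|<- i]; last by rewrite pre_length => H; rewrite nth_pre.
apply: (nth_ext _ _ false false); rewrite pre_length // => i Hi.
by rewrite nth_pre // H.
Qed.

Lemma prefix_app m x : prefix m (m ^^ x).
Proof. apply/prefix_pre; exact: pre_app. Qed.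

Lemma prefixP m x : prefix m x -> x = m ^^ drop (length m) x.
Proof. move/prefix_pre => E. by rewrite -{1}E app_pre_drop. Qed.

Lemma prefix_pre_self x n : prefix (pre x n) x.
Proof. apply/prefix_pre. by rewrite pre_length. Qed.

Lemma prefix_dec m x : {prefix m x} + {~ prefix m x}.
Proof. exact: excluded_middle_informative. Qed.

Lemma prefix_app_split m n x : prefix (m ++ n) x -> prefix m x.
Proof. move/prefixP => ->. rewrite app_word_app. exact: prefix_app. Qed.

Lemma prefix_app_app m n x : prefix (m ++ n) (m ^^ x) <-> prefix n x.
Proof.
split=> /prefixP H; last by rewrite H -app_word_app; apply: prefix_app.
rewrite app_word_app in H. move/app_word_inj: H => ->. exact: prefix_app.
Qed.

Lemma prefix_nested m n x :
  prefix m x -> prefix n x -> length m <= length n -> exists s, n = m ++ s.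
Proof.
move=> /prefix_pre Hm /prefix_pre Hn L. exists (pre (drop (length m) x) (length n - length m)).
rewrite -{1}Hm -pre_add -{1}Hn. f_equal; lia.
Qed.

Lemma app_word_eq_len m n x y : length m = length n -> m ^^ x = n ^^ y -> m = n /\ x = y.
Proof.
move=> L E. have Emn : m = n by rewrite -(pre_app m x) E L pre_app.
subst n. split=> //. exact: app_word_inj E.
Qed.

Lemma app_word_fun_inj m n : (forall z, m ^^ z = n ^^ z) -> m = n.
Proof.
have W : forall m n, length m <= length n -> (forall z, m ^^ z = n ^^ z) -> m = n.
  move=> {}m {}n L H.
  have [s E] : exists s, n = m ++ s.
    apply: (prefix_nested m n (m ^^ zeroC)) => //; first exact: prefix_app.
    rewrite H; exact: prefix_app.
  subst n. case: s H {L} => [|b s] H; first by rewrite app_nil_r.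
  (* If [n] extends [m] by [b :: s], the sequence constantly [negb b] would equal a sequence
     starting with [b]. *)
  have := H (fun _ => negb b). rewrite app_word_app => /app_word_inj /(f_equal (fun f => f 0)).
  rewrite app_word_lt /=; [lia|]. by case: b {H}.
move=> H. case: (Nat.le_ge_cases (length m) (length n)) => L; first exact: W.
symmetry; exact: W.
Qed.

(** * Thompson's group V *)

Definition loc (v : Cantor -> Cantor) m m' := forall z, v (m ^^ z) = m' ^^ z.

Lemma loc_ext v m m' s : loc v m m' -> loc v (m ++ s) (m' ++ s).
Proof. move=> H z. by rewrite !app_word_app H. Qed.

(** Of two words through [x] the longer extends the shorter, and its image word is then extended by
    the same suffix. This makes the slope independent of the table picked by [epsilon] in
    [lslope]. *)
Lemma loc_slope_unique v m m' n n' x :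
  loc v m m' -> loc v n n' -> prefix m x -> prefix n x ->
  (Z.of_nat (length m) - Z.of_nat (length m') = Z.of_nat (length n) - Z.of_nat (length n'))%Z.
Proof.
have W : forall m m' n n', length m <= length n -> loc v m m' -> loc v n n' ->
    prefix m x -> prefix n x ->
    (Z.of_nat (length m) - Z.of_nat (length m') = Z.of_nat (length n) - Z.of_nat (length n'))%Z.
  move=> {}m {}m' {}n {}n' L Hm Hn Pm Pn.
  have [s E] := prefix_nested _ _ _ Pm Pn L. subst n.
  have -> : n' = m' ++ s.
    apply: app_word_fun_inj => z. by rewrite -Hn (loc_ext _ _ _ _ Hm).
  rewrite !length_app. lia.
move=> Hm Hn Pm Pn.
case: (Nat.le_ge_cases (length m) (length n)) => L; first exact: W.
symmetry; exact: W.
Qed.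

(** * Bijections and chosen inverses *)

Definition bij (f : Cantor -> Cantor) :=
  exists g, (forall x, g (f x) = x) /\ (forall x, f (g x) = x).

Lemma bij_inj f x y : bij f -> f x = f y -> x = y.
Proof. move=> [g [H _]] E. by rewrite -(H x) E H. Qed.

Lemma finv_r f x : bij f -> f (finv f x) = x.
Proof.
move=> [g [_ H]]. exact: (epsilon_spec (inhabits x) (fun y => f y = x) (ex_intro _ (g x) (H x))).
Qed.

Lemma finv_l f x : bij f -> finv f (f x) = x.
Proof. move=> B. apply: (bij_inj _ _ _ B). exact: finv_r. Qed.

Lemma finv_eq f x y : bij f -> f x = y -> finv f y = x.
Proof. move=> B <-. exact: finv_l. Qed.

Lemma finv_bij f : bij f -> bij (finv f).
Proof. move=> B. exists f. split=> x; [exact: finv_r|exact: finv_l]. Qed.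

Lemma bij_comp f g : bij f -> bij g -> bij (fun x => f (g x)).
Proof.
move=> Bf Bg. exists (fun x => finv g (finv f x)).
split=> x; by rewrite ?finv_l ?finv_r // ?finv_l // finv_r.
Qed.

Lemma finv_comp f g : bij f -> bij g -> finv (fun x => f (g x)) = (fun x => finv g (finv f x)).
Proof.
move=> Bf Bg. extensionality x. apply: finv_eq; first exact: bij_comp.
by rewrite !finv_r.
Qed.

Lemma bij_id : bij (fun x => x).
Proof. by exists (fun x => x). Qed.

Lemma finv_id : finv (fun x => x) = (fun x => x).
Proof. extensionality x. apply: finv_eq => //. exact: bij_id. Qed.

Lemma finv_finv f : bij f -> finv (finv f) = f.
Proof. move=> B. extensionality x. apply: finv_eq; [exact: finv_bij|exact: finv_l]. Qed.

Lemma finv_uniq f g : (forall x, g (f x) = x) -> (forall x, f (g x) = x) -> finv f = g.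
Proof.
move=> Hl Hr. extensionality x. apply: finv_eq => //. by exists g.
Qed.

Lemma bij_of_inj_surj f :
  (forall x y, f x = f y -> x = y) -> (forall y, exists x, f x = y) -> bij f.
Proof.
move=> I S. have R y : f (finv f y) = y.
  exact: (epsilon_spec (inhabits y) (fun x => f x = y) (S y)).
exists (finv f). split=> // x. apply: I; exact: R.
Qed.

(** Together with bijectivity this local condition characterises V ([isV_intro]), so closure under
    composition and inversion needs no manipulation of partitions. *)
Definition locally_affine v := forall x, exists m m', prefix m x /\ loc v m m'.

Lemma isVrep_loc v ps k : isVrep v ps -> k < length ps ->
  loc v (fst (nth k ps (nil, nil))) (snd (nth k ps (nil, nil))).
Proof. move=> [_ [_ H]] Hk z. exact: H. Qed.

Lemma nth_map_fst k (ps : list (list bool * list bool)) :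
  nth k (map fst ps) nil = fst (nth k ps (nil, nil)).
Proof. exact: (map_nth fst ps (nil, nil) k). Qed.

Lemma nth_map_snd k (ps : list (list bool * list bool)) :
  nth k (map snd ps) nil = snd (nth k ps (nil, nil)).
Proof. exact: (map_nth snd ps (nil, nil) k). Qed.

Lemma isVrep_dom v ps x : isVrep v ps -> exists k, k < length ps /\
  prefix (fst (nth k ps (nil, nil))) x.
Proof.
move=> [H _]. have [k [[Hk P] _]] := H x. exists k.
by rewrite length_map in Hk; rewrite nth_map_fst in P.
Qed.

Lemma isVrep_ran v ps x : isVrep v ps -> exists k, k < length ps /\
  prefix (snd (nth k ps (nil, nil))) x.
Proof.
move=> [_ [H _]]. have [k [[Hk P] _]] := H x. exists k.
by rewrite length_map in Hk; rewrite nth_map_snd in P.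
Qed.

Lemma isV_locally_affine v : isV v -> locally_affine v.
Proof.
move=> [ps H] x. have [k [Hk P]] := isVrep_dom _ _ x H.
by do 2 eexists; split; [exact: P|exact: isVrep_loc].
Qed.

Lemma isV_bij v : isV v -> bij v.
Proof.
move=> [ps H]. apply: bij_of_inj_surj => [x y E|y].
  have [k [Hk P]] := isVrep_dom _ _ x H.
  have [j [Hj P']] := isVrep_dom _ _ y H.
  move: E. rewrite (prefixP _ _ P) (prefixP _ _ P') !(isVrep_loc v ps) // => E.
  case: (H) => _ [H2 _].
  have [i [_ U]] := H2 (snd (nth k ps (nil, nil)) ^^ drop (length (fst (nth k ps (nil, nil)))) x).
  have Ek : i = k.
    apply: U. rewrite length_map nth_map_snd. split=> //; exact: prefix_app.
  have Ej : i = j.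
    apply: U. rewrite length_map nth_map_snd E. split=> //; exact: prefix_app.
  subst. by move/app_word_inj: E => ->.
have [k [Hk P]] := isVrep_ran _ _ y H.
exists (fst (nth k ps (nil, nil)) ^^ drop (length (snd (nth k ps (nil, nil)))) y).
rewrite (isVrep_loc v ps) //. by rewrite -(prefixP _ _ P).
Qed.

Definition unif_affine v (n : nat) := forall m, length m = n -> exists m', loc v m m'.

(* Compactness: otherwise some branch of words, none of which is eventually
   uniformly affine, converges to a point where [v] is not locally affine. *)
Lemma locally_affine_unif v : locally_affine v -> exists n, unif_affine v n.
Proof.
move=> LA.
pose good m := exists n, forall s, length s = n -> exists m', loc v (m ++ s) m'.
have good_split m : good (m ++ [false]) -> good (m ++ [true]) -> good m.
  move=> [n0 H0] [n1 H1]. exists (S (n0 + n1)).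
  have E m0 n2 : (forall s, length s = n2 -> exists m', loc v (m0 ++ s) m') ->
      forall s, n2 <= length s -> exists m', loc v (m0 ++ s) m'.
    move=> H s L. have [m' Hm'] := H (firstn n2 s) ltac:(rewrite length_firstn; lia).
    exists (m' ++ skipn n2 s). rewrite -{1}(firstn_skipn n2 s) app_assoc. exact: loc_ext.
  case=> [|b s] /= L; first lia.
  have := E _ _ H0 s ltac:(lia). have := E _ _ H1 s ltac:(lia).
  rewrite -!app_assoc /=. by case: b {L}.
apply: NNPP => N.
have bad0 : ~ good [] by move=> [n H]; apply: N; exists n.
pose next m := m ++ [if excluded_middle_informative (good (m ++ [false])) then true else false].
have bad_next m : ~ good m -> ~ good (next m).
  rewrite /next. case: excluded_middle_informative => // H B B'. exact: B (good_split _ H B').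
pose w n := Nat.iter n next [].
have bw n : ~ good (w n) by elim: n => //= n IH; apply: bad_next.
have Lw n : length (w n) = n by elim: n => //= n IH; rewrite /next length_app /= -/(w n) IH; lia.
pose x : Cantor := fun i => nth i (w (S i)) false.
have Pw n : prefix (w n) x.
  elim: n => [|n IH] i; first by rewrite Lw; lia.
  rewrite Lw => Hi. case: (Nat.eq_dec i n) => [->//|ne].
  have Hi' : i < n by lia.
  rewrite (IH i); first by rewrite Lw.
  by rewrite -[w (S n)]/(next (w n)) /next app_nth1 // Lw.
have [m [m' [Pm Hm]]] := LA x.
have Em : w (length m) = m.
  move: (Pw (length m)) Pm => /prefix_pre. by rewrite Lw => <- /prefix_pre.
apply: (bw (length m)). rewrite Em. exists 0. case=> // _. exists m'. by rewrite app_nil_r.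
Qed.

Fixpoint words n : list (list bool) :=
  match n with
  | 0 => [[]]
  | S n => map (cons false) (words n) ++ map (cons true) (words n)
  end.

Lemma in_words n m : In m (words n) <-> length m = n.
Proof.
elim: n m => [|n IH] m /=.
  split; first by case=> // <-. by case: m => //; left.
rewrite in_app_iff !in_map_iff. split.
  by case=> -[s [<- /IH E]] /=; rewrite E.
case: m => [|b s] //= [E]. case: b; [right|left]; exists s; split=> //; exact/IH.
Qed.

Lemma words_NoDup n : NoDup (words n).
Proof.
elim: n => [|n IH] /=; first by constructor; [case|constructor].
apply: NoDup_app.
- by apply: FinFun.Injective_map_NoDup => // s t [].
- by apply: FinFun.Injective_map_NoDup => // s t [].
- move=> m /in_map_iff [s [<- _]] /in_map_iff [t [E _]]. discriminate.
Qed.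

(** By compactness all words of one length [n] serve as the domain partition; their image words
    partition the target because [v] is bijective. *)
Lemma isV_intro v : bij v -> locally_affine v -> isV v.
Proof.
move=> B /locally_affine_unif [n U].
pose im m := epsilon (inhabits nil) (fun m' => loc v m m').
have Him m : length m = n -> loc v m (im m) by move/U => H; exact: epsilon_spec.
pose ps := map (fun m => (m, im m)) (words n).
have Efst : map fst ps = words n by rewrite /ps map_map /= map_id.
have Lps : length ps = length (words n) by rewrite length_map.
have Eps k : k < length ps -> nth k ps (nil, nil) = (nth k (words n) nil, im (nth k (words n) nil)).
  (* [map_nth] expects a default that is itself an image, hence the change from [(nil, nil)]; the
     index bound makes it harmless. *)
  move=> Hk. rewrite /ps (nth_indep _ _ (nil, im nil)) //.
  exact: (map_nth (fun m => (m, im m))).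
have Hnth k : k < length ps -> length (nth k (words n) nil) = n.
  move=> Hk. apply/in_words. apply: nth_In. by rewrite -Lps.
have find x : exists k, k < length ps /\ nth k (words n) nil = pre x n.
  have /(In_nth _ _ nil) [k [Hk E]] : In (pre x n) (words n) by apply/in_words; rewrite pre_length.
  exists k. by rewrite Lps.
have inj k j : k < length ps -> j < length ps ->
    nth k (words n) nil = nth j (words n) nil -> k = j.
  rewrite Lps => Hk Hj. by have /(NoDup_nth _ nil) := words_NoDup n; apply.
exists ps. split; [|split].
- move=> x. have [k [Hk E]] := find x. exists k. rewrite Efst -Lps. split.
    by rewrite E; split=> //; apply: prefix_pre_self.
  move=> j [Hj P]. apply: inj => //. rewrite E.
  move/prefix_pre: P. by rewrite Hnth.
- move=> x. have [k [Hk E]] := find (finv v x). exists k.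
  have Lc j : j < length ps -> loc v (nth j (words n) nil) (im (nth j (words n) nil)).
    by move=> Hj; apply: Him; apply: Hnth.
  split.
    rewrite length_map nth_map_snd Eps //=. split=> //. have := Lc k Hk (drop n (finv v x)).
    rewrite {1}E app_pre_drop finv_r // => ->. exact: prefix_app.
  move=> j. rewrite length_map nth_map_snd => -[Hj]. rewrite Eps //= => /prefixP Ex. apply: inj => //. rewrite E.
  rewrite -Lc // in Ex. rewrite {1}Ex finv_l //.
  by rewrite -[RHS](pre_app _ (drop (length (im (nth j (words n) nil))) x)) Hnth.
- move=> k Hk x. rewrite Eps //=. apply: Him. exact: Hnth.
Qed.

Lemma isV_id : isV (fun x => x).
Proof.
apply: isV_intro; first exact: bij_id.
move=> x. exists [], []. split=> // i /=; lia.
Qed.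

Lemma comp_common v w x : locally_affine v -> locally_affine w -> exists m m' m'',
  prefix m x /\ loc w m m' /\ prefix m' (w x) /\ loc v m' m''.
Proof.
move=> LAv LAw. have [m [m' [Pm Hm]]] := LAw x.
have [n [n' [Pn Hn]]] := LAv (w x).
pose s := pre (drop (length m) x) (length n).
have Ex : prefix (m ++ s) x.
  rewrite {1}(prefixP _ _ Pm). apply/prefix_app_app. exact: prefix_pre_self.
have Ewx : prefix (m' ++ s) (w x).
  rewrite (prefixP _ _ Ex). by rewrite (loc_ext _ _ _ _ Hm); apply: prefix_app.
have [r Er] : exists r, m' ++ s = n ++ r.
  apply: prefix_nested Pn Ewx _. rewrite length_app pre_length. lia.
exists (m ++ s), (m' ++ s), (n' ++ r). split=> //. split; first exact: loc_ext.
split=> //. rewrite Er. exact: loc_ext.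
Qed.

Lemma isV_comp v w : isV v -> isV w -> isV (fun x => v (w x)).
Proof.
move=> Hv Hw. apply: isV_intro; first by apply: bij_comp; apply: isV_bij.
move=> x. have [m [m' [m'' [P [H1 [_ H2]]]]]] :=
  comp_common _ _ x (isV_locally_affine _ Hv) (isV_locally_affine _ Hw).
exists m, m''. split=> // z. by rewrite H1 H2.
Qed.

Lemma loc_finv v m m' : bij v -> loc v m m' -> loc (finv v) m' m.
Proof. move=> B H z. apply: finv_eq => //. Qed.

Lemma isV_finv v : isV v -> isV (finv v).
Proof.
move=> H. have B := isV_bij _ H. apply: isV_intro; first exact: finv_bij.
move=> x. have [m [m' [P L]]] := isV_locally_affine _ H (finv v x).
exists m', m. split; last exact: loc_finv.
rewrite -(finv_r v x B) (prefixP _ _ P) L. exact: prefix_app.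
Qed.

(** * Continuity and the chain rule for slopes *)

Lemma contC_id : contC (fun x => x).
Proof. move=> x n. exists n. done. Qed.

Lemma contC_comp f g : contC f -> contC g -> contC (fun x => f (g x)).
Proof.
move=> Cf Cg x n. have [m Hm] := Cf (g x) n. have [k Hk] := Cg x m.
exists k => y Hy. apply: Hm. exact: Hk.
Qed.

Lemma isV_cont v : isV v -> contC v.
Proof.
move=> H x n. have [m [m' [P L]]] := isV_locally_affine _ H x.
exists (length m + n) => y Hy.
have Py : prefix m y.
  move=> i Hi. rewrite Hy; [lia|]. exact: P.
move=> i Hi. rewrite (prefixP _ _ P) (prefixP _ _ Py) !L.
case: (Nat.lt_ge_cases i (length m')) => Hi'; first by rewrite !app_word_lt.
rewrite !app_word_ge // /drop. apply: Hy. lia.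
Qed.

Lemma lslope_loc v m m' x : isV v -> prefix m x -> loc v m m' ->
  lslope v x = (Z.of_nat (length m) - Z.of_nat (length m'))%Z.
Proof.
move=> [ps0 H0] P L. have E : exists n, slope_rel v x n.
  have [k [Hk Pk]] := isVrep_dom _ _ x H0.
  by eexists; exists ps0; split=> //; exists k.
have [ps [H [k [Hk [Pk Es]]]]] := epsilon_spec (inhabits 0%Z) _ E.
rewrite /lslope Es.
apply: (loc_slope_unique v) Pk P => //. exact: isVrep_loc.
Qed.

Lemma lslope_comp v w x : isV v -> isV w ->
  lslope (fun y => v (w y)) x = (lslope w x + lslope v (w x))%Z.
Proof.
move=> Hv Hw. have [m [m' [m'' [P [H1 [P' H2]]]]]] :=
  comp_common _ _ x (isV_locally_affine _ Hv) (isV_locally_affine _ Hw).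
rewrite (lslope_loc _ m m'') //; first exact: isV_comp.
  by move=> z; rewrite H1 H2.
rewrite (lslope_loc w m m') // (lslope_loc v m' m'') //. lia.
Qed.

Lemma lslope_id x : lslope (fun y => y) x = 0%Z.
Proof. rewrite (lslope_loc _ [] []) //; [exact: isV_id|by move=> i /=; lia]. Qed.

Lemma lslope_finv v x : isV v -> lslope (finv v) (v x) = (- lslope v x)%Z.
Proof.
move=> H. have := lslope_comp (finv v) v x (isV_finv _ H) H.
have -> : (fun y => finv v (v y)) = (fun y => y).
  by extensionality y; rewrite finv_l //; apply: isV_bij.
rewrite lslope_id. lia.
Qed.

(** * Dyadic points *)

Lemma inQ2_zero : inQ2 zeroC.
Proof. by exists 0. Qed.

Lemma inQ2_app m x : inQ2 (m ^^ x) <-> inQ2 x.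
Proof.
split=> -[N H].
  exists N => n Hn. rewrite -(app_word_shift m). apply: H. lia.
exists (length m + N) => n Hn. rewrite app_word_ge; [lia|]. apply: H. lia.
Qed.

Lemma inQ2_pre x : inQ2 x -> exists N, forall k, N <= k -> x = pre x k ^^ zeroC.
Proof.
move=> [N H]. exists N => k Hk. rewrite -{1}(app_pre_drop x k). f_equal.
extensionality i. apply: H. lia.
Qed.

Lemma inQ2_isV v x : isV v -> inQ2 x <-> inQ2 (v x).
Proof.
move=> H. have [m [m' [P L]]] := isV_locally_affine _ H x.
rewrite (prefixP _ _ P) L !inQ2_app. done.
Qed.

Lemma inQ2_finv v x : isV v -> inQ2 x -> inQ2 (finv v x).
Proof. move=> H. exact: (proj1 (inQ2_isV _ _ (isV_finv _ H))). Qed.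

Lemma cont_dense f g : contC f -> contC g -> (forall x, inQ2 x -> f x = g x) -> f = g.
Proof.
move=> Cf Cg H. extensionality x. extensionality i.
have [a Ha] := Cf x (S i). have [b Hb] := Cg x (S i).
pose y := pre x (a + b) ^^ zeroC.
have Hy j : j < a + b -> y j = x j.
  by move=> Hj; rewrite /y app_word_lt ?pre_length // nth_pre.
rewrite -(Ha y); [by move=> j Hj; apply: Hy; lia|lia|].
rewrite -(Hb y); [by move=> j Hj; apply: Hy; lia|lia|].
rewrite H //. apply/inQ2_app. exact: inQ2_zero.
Qed.

(** * Disjoint cones and their swaps *)

Definition disj m n := forall x, prefix m x -> prefix n x -> False.

Lemma disj_sym m n : disj m n -> disj n m.
Proof. move=> H x P Q. exact: H Q P. Qed.

Lemma disj_app m n s t : disj m n -> disj (m ++ s) (n ++ t).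
Proof. move=> H x P Q. exact: H x (prefix_app_split _ _ _ P) (prefix_app_split _ _ _ Q). Qed.

Lemma disj_sub m s t : disj s t -> disj (m ++ s) (m ++ t).
Proof.
move=> H x P Q. have E := prefixP _ _ (prefix_app_split _ _ _ P).
rewrite E in P Q. exact: (H _ (proj1 (prefix_app_app _ _ _) P) (proj1 (prefix_app_app _ _ _) Q)).
Qed.

Lemma disj_cons b c s t : b <> c -> disj (b :: s) (c :: t).
Proof.
move=> H x P Q. have := P 0 ltac:(simpl; lia). have := Q 0 ltac:(simpl; lia).
rewrite /= => -> E. by apply: H.
Qed.

Lemma disj_same_length m n : length m = length n -> m <> n -> disj m n.
Proof. move=> L N x /prefix_pre P /prefix_pre Q. apply: N. by rewrite -P -Q L. Qed.

Definition swap m n : Cantor -> Cantor := fun x =>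
  if prefix_dec m x then n ^^ drop (length m) x
  else if prefix_dec n x then m ^^ drop (length n) x else x.

Lemma swap_l m n : loc (swap m n) m n.
Proof.
move=> z. rewrite /swap. case: prefix_dec => [_|[]]; last exact: prefix_app.
by rewrite drop_app.
Qed.

Lemma swap_r m n : disj m n -> loc (swap m n) n m.
Proof.
move=> D z. rewrite /swap. case: prefix_dec => [P|_].
  case: (D _ P (prefix_app n z)).
case: prefix_dec => [_|[]]; last exact: prefix_app.
by rewrite drop_app.
Qed.

Lemma swap_out m n x : ~ prefix m x -> ~ prefix n x -> swap m n x = x.
Proof. move=> H H'. rewrite /swap. by case: (prefix_dec m x) => //; case: (prefix_dec n x). Qed.

Lemma swap_loc_out m n p : disj m p -> disj n p -> loc (swap m n) p p.
Proof.
move=> D D' z. have Pz := prefix_app p z. apply: swap_out => P; [exact: D P Pz|exact: D' P Pz].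
Qed.

Lemma swap_invol m n x : disj m n -> swap m n (swap m n x) = x.
Proof.
move=> D. case: (prefix_dec m x) => [/prefixP ->|H]; first by rewrite swap_l swap_r.
case: (prefix_dec n x) => [/prefixP ->|H']; first by rewrite swap_r // swap_l.
by rewrite !swap_out.
Qed.

Lemma isV_swap m n : disj m n -> isV (swap m n).
Proof.
move=> D. apply: isV_intro.
  by exists (swap m n); split=> x; apply: swap_invol.
move=> x. case: (prefix_dec m x) => H; first by exists m, n; split=> //; apply: swap_l.
case: (prefix_dec n x) => H'; first by exists n, m; split=> //; apply: swap_r.
(* The point lies in neither cone, and its prefix of this length is at least as long as [m] and as
   [n], so the cone of [p] meets neither. *)
pose p := pre x (length m + length n). exists p, p. split; first exact: prefix_pre_self.
have Dp q : length q <= length m + length n -> ~ prefix q x -> disj q p.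
  move=> L N y P Q. apply: N. have [s E] : exists s, p = q ++ s.
    apply: (prefix_nested _ _ y) => //. by rewrite pre_length.
  apply: (prefix_app_split _ s). rewrite -E. exact: prefix_pre_self.
apply: swap_loc_out; apply: Dp => //; lia.
Qed.

Lemma swap_finv m n : disj m n -> finv (swap m n) = swap m n.
Proof. move=> D. apply: finv_uniq => x; exact: swap_invol. Qed.

(** * The dyadic valuation and the cocycle of slopes *)

Lemma nu_rel_fun x k k' : nu_rel x k -> nu_rel x k' -> k = k'.
Proof.
move=> [[H ->]|[i [H [H' ->]]]] [[J ->]|[j [J [J' ->]]]] //.
- by rewrite H in J.
- by rewrite J in H.
- have -> // : i = j.
  case: (Nat.lt_total i j) => [L|[//|L]].
  + by rewrite H' in J.
  + by rewrite J' in H.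
Qed.

Lemma nuE x k : nu_rel x k -> nu x = k.
Proof.
move=> H. apply: (nu_rel_fun x) => //. apply: epsilon_spec. by exists k.
Qed.

Lemma last_digit x : inQ2 x -> x <> zeroC ->
  exists i, x i = true /\ forall j, i < j -> x j = false.
Proof.
move=> [N]. elim: N => [|N IH] H ne.
  case: ne. extensionality i. apply: H. lia.
case E: (x N).
  exists N. split=> [//|j Hj]. apply: H. lia.
apply: IH => // n Hn. case: (Nat.eq_dec n N) => [->//|ne']. apply: H. lia.
Qed.

(** The exclusion of [zeroC] matters: with [nu zeroC = 0], the valuation of [m ^^ zeroC] depends on
    the last nonzero digit of [m]. These points are the finitely many exceptions in [p_v_finite]. *)
Lemma nu_app m z : inQ2 z -> z <> zeroC -> nu (m ^^ z) = (nu z - Z.of_nat (length m))%Z.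
Proof.
move=> Hz nz. have [i [Hi Hj]] := last_digit _ Hz nz.
rewrite (nuE z (- Z.of_nat (S i))); first by right; exists i.
apply: nuE. right. exists (length m + i). rewrite app_word_shift. split=> //. split; last lia.
move=> j H. rewrite app_word_ge; [lia|]. apply: Hj. lia.
Qed.

Lemma p_v_id x : p_v (fun y => y) x = 0%Z.
Proof. rewrite /p_v lslope_id finv_id. lia. Qed.

(** The slope term is a cocycle by the chain rule, and the two [nu] terms form a coboundary. *)
Lemma p_v_comp v w x : isV v -> isV w ->
  p_v (fun y => v (w y)) x = (p_v v x + p_v w (finv v x))%Z.
Proof.
move=> Hv Hw. rewrite /p_v finv_comp; try exact: isV_bij.
rewrite lslope_comp // finv_r; first exact: isV_bij. lia.
Qed.

Lemma p_v_fixed v : isV v -> v zeroC = zeroC -> p_v v zeroC = lslope v zeroC.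
Proof.
move=> H E. rewrite /p_v.
have -> : finv v zeroC = zeroC by apply: finv_eq => //; exact: isV_bij.
lia.
Qed.

(* On a cone both [nu] and the slope see only the change of word length. *)
Lemma p_v_finite v : isV v -> exists l, forall x, inQ2 x -> p_v v x <> 0%Z -> In x l.
Proof.
move=> H. have B := isV_bij _ H. case: (H) => ps R.
exists (map (fun p => snd p ^^ zeroC) ps) => x Hx.
have [k [Hk P]] := isVrep_dom _ _ (finv v x) R.
have L := isVrep_loc _ _ _ R Hk.
set m := fst _ in L P. set m' := snd _ in L.
pose z := drop (length m) (finv v x). have Ey : finv v x = m ^^ z := prefixP _ _ P.
have Ex : x = m' ^^ z by rewrite -L -Ey finv_r.
case: (excluded_middle_informative (z = zeroC)) => [Ez _|nz].
  apply/in_map_iff. exists (nth k ps (nil, nil)). split; last exact: nth_In.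
  by rewrite Ex Ez.
have Hz : inQ2 z by apply/(inQ2_app m'); rewrite -Ex.
case. rewrite /p_v (lslope_loc v m m') // Ey {1}Ex !nu_app //. lia.
Qed.

(** * Transitivity of V on dyadic points *)

Lemma pre_separate F q : exists K, forall k, K <= k -> forall p, In p F -> p <> q -> pre p k <> pre q k.
Proof.
elim: F => [|p F [K HK]]; first by exists 0 => k _ p [].
case: (excluded_middle_informative (p = q)) => [E|ne].
  exists K => k Hk r [<-|Hr] //. exact: HK.
have [i Hi] : exists i, p i <> q i.
  apply: NNPP => N. apply: ne. extensionality i. apply: NNPP => N'. apply: N. by exists i.
exists (S i + K) => k Hk r [<- _ E|Hr]; last by apply: HK => //; lia.
apply: Hi. apply: pre_eq E _. lia.
Qed.

(** The cones of [q] and [r] are swapped at a depth where both tails are zero, so that [q] lands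
    exactly on [r], and where no other point of [F] lies in either cone. *)
Lemma move_point F q r : inQ2 q -> inQ2 r -> exists s, isV s /\ s q = r /\
  forall p, In p F -> p <> q -> p <> r -> s p = p.
Proof.
move=> Hq Hr. case: (excluded_middle_informative (q = r)) => [<-|ne].
  exists (fun x => x). split; [exact: isV_id|by []].
have [Kq HKq] := pre_separate F q. have [Kr HKr] := pre_separate (q :: F) r.
have [Nq HNq] := inQ2_pre _ Hq. have [Nr HNr] := inQ2_pre _ Hr.
pose k := Kq + Kr + Nq + Nr.
have D : disj (pre q k) (pre r k).
  apply: disj_same_length; first by rewrite !pre_length.
  apply: HKr => //; [lia|by left].
exists (swap (pre q k) (pre r k)). split; first exact: isV_swap. split.
  by rewrite {2}(HNq k) ?swap_l -?HNr //; lia.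
move=> p Hp nq nr. apply: swap_out => /prefix_pre; rewrite pre_length.
  apply: HKq => //; lia.
by apply: HKr => //; [lia|right].
Qed.

(** A nonzero point that agrees with 0 to a depth at which every nonzero point of [F] has already
    left it cannot belong to [F]; it is not 0 either. *)
Lemma fresh_point F : exists r, inQ2 r /\ ~ In r F.
Proof.
have [K HK] := pre_separate F zeroC.
exists (pre zeroC K ^^ [true] ^^ zeroC). split; first by rewrite !inQ2_app; apply: inQ2_zero.
move=> I. apply: (HK K (le_n _) _ I).
  move/(f_equal (fun x => x K)). rewrite app_word_ge pre_length // Nat.sub_diag.
  by rewrite app_word_lt /=; [lia|].
rewrite -{2}(pre_app (pre zeroC K) ([true] ^^ zeroC)). by rewrite pre_length.
Qed.

Lemma isV_transitive q r : inQ2 q -> inQ2 r -> exists s, isV s /\ s q = r.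
Proof. move=> Hq Hr. have [s [H [E _]]] := move_point [] q r Hq Hr. by exists s. Qed.

Lemma isV_two_transitive x1 x2 y1 y2 : inQ2 x1 -> inQ2 x2 -> inQ2 y1 -> inQ2 y2 ->
  x1 <> x2 -> y1 <> y2 -> exists s, isV s /\ s x1 = y1 /\ s x2 = y2.
Proof.
move=> H1 H2 J1 J2 nx ny. have [s [Hs Es]] := isV_transitive _ _ H1 J1.
have [t [Ht [Et Ft]]] := move_point [y1] (s x2) y2 (proj1 (inQ2_isV _ _ Hs) H2) J2.
exists (fun x => t (s x)). split; first exact: isV_comp. split=> //.
rewrite Es. apply: Ft => //; first by left.
rewrite -Es => /(bij_inj _ _ _ (isV_bij _ Hs)). done.
Qed.

Lemma isV_push_off L T : (forall q, In q L -> inQ2 q) ->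
  exists v, isV v /\ forall q, In q L -> ~ In (v q) T.
Proof.
elim: L => [|q L IH] HL; first by exists (fun x => x); split; [exact: isV_id|].
have [v [Hv Fv]] := IH (fun p Hp => HL p (or_intror Hp)).
(* Avoiding [map v L] as well ensures that the move of [v q] to [r] fixes the other images, which
   already lie outside [T]. *)
have [r [Hr Nr]] := fresh_point (T ++ map v L).
have [s [Hs [Es Fs]]] :=
  move_point (map v L) (v q) r (proj1 (inQ2_isV _ _ Hv) (HL q (or_introl eq_refl))) Hr.
have NrT : ~ In r T by move=> I; apply: Nr; apply/in_app_iff; left.
exists (fun x => s (v x)). split; first exact: isV_comp.
move=> p [<-|Hp]; first by rewrite Es.
case: (excluded_middle_informative (v p = v q)) => [->|ne]; first by rewrite Es.
have Ip : In (v p) (map v L) by apply: in_map.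
rewrite Fs //; last exact: Fv.
move=> E. apply: Nr. apply/in_app_iff; right. by rewrite -E.
Qed.

Lemma digit_split (x : Cantor) : x = [x 0] ^^ drop 1 x.
Proof. by rewrite -{1}(app_pre_drop x 1). Qed.

(* A standard generator of Thompson's group F, with slope 2 at its fixed point 0. *)
Definition g0 : Cantor -> Cantor := fun x =>
  if x 0 then [true; true] ^^ drop 1 x
  else if x 1 then [true; false] ^^ drop 2 x else [false] ^^ drop 2 x.
Definition g0' : Cantor -> Cantor := fun x =>
  if x 0 then if x 1 then [true] ^^ drop 2 x else [false; true] ^^ drop 2 x
  else [false; false] ^^ drop 1 x.

Lemma g0_00 : loc g0 [false; false] [false].
Proof. move=> z. by rewrite /g0 !app_word_lt /=; try lia; rewrite (drop_app [false;false]). Qed.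
Lemma g0_01 : loc g0 [false; true] [true; false].
Proof. move=> z. by rewrite /g0 !app_word_lt /=; try lia; rewrite (drop_app [false;true]). Qed.
Lemma g0_1 : loc g0 [true] [true; true].
Proof. move=> z. by rewrite /g0 app_word_lt /=; [lia|]; rewrite (drop_app [true]). Qed.
Lemma g0'_0 : loc g0' [false] [false; false].
Proof. move=> z. by rewrite /g0' app_word_lt /=; [lia|]; rewrite (drop_app [false]). Qed.
Lemma g0'_10 : loc g0' [true; false] [false; true].
Proof. move=> z. by rewrite /g0' !app_word_lt /=; try lia; rewrite (drop_app [true;false]). Qed.
Lemma g0'_11 : loc g0' [true; true] [true].
Proof. move=> z. by rewrite /g0' !app_word_lt /=; try lia; rewrite (drop_app [true;true]). Qed.

Lemma two_digits x : exists y, x = [x 0; x 1] ^^ y.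
Proof.
exists (drop 2 x). by rewrite -{1}(app_pre_drop x 2).
Qed.

Lemma app_cons b m x : (b :: m) ^^ x = [b] ^^ m ^^ x.
Proof. by rewrite -app_word_app. Qed.

Lemma g0_bij : bij g0.
Proof.
exists g0'. split=> x.
- have [y ->] := two_digits x. case: (x 0).
    by rewrite app_cons g0_1 g0'_11.
  by case: (x 1); rewrite ?g0_01 ?g0_00 ?g0'_10 ?g0'_0.
- have [y ->] := two_digits x. case: (x 0); last first.
    by rewrite app_cons g0'_0 g0_00.
  by case: (x 1); rewrite ?g0'_11 ?g0'_10 ?g0_1 ?g0_01.
Qed.

Lemma isV_g0 : isV g0.
Proof.
apply: isV_intro; first exact: g0_bij.
move=> x. rewrite (digit_split x). case E: (x 0).
  exists [true], [true; true]. split; [exact: prefix_app|exact: g0_1].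
rewrite (digit_split (drop 1 x)) -app_word_app /=. case: (drop 1 x 0).
  exists [false; true], [true; false]. split; [exact: prefix_app|exact: g0_01].
exists [false; false], [false]. split; [exact: prefix_app|exact: g0_00].
Qed.

Lemma app_zero n : repeat false n ^^ zeroC = zeroC.
Proof.
extensionality i. case: (Nat.lt_ge_cases i n) => H.
  rewrite app_word_lt ?repeat_length //. exact: nth_repeat.
by rewrite app_word_ge ?repeat_length.
Qed.

Lemma prefix_zero n : prefix (repeat false n) zeroC.
Proof. rewrite -(app_zero n). exact: prefix_app. Qed.

Lemma prefix_zero_repeat m : prefix m zeroC -> m = repeat false (length m).
Proof.
move/prefix_pre => E. rewrite -{1}E.
have := pre_app (repeat false (length m)) zeroC. by rewrite app_zero repeat_length.
Qed.

Lemma g0_zero : g0 zeroC = zeroC.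
Proof. by rewrite -{1}(app_zero 2) g0_00 (app_zero 1). Qed.

Lemma lslope_g0 : lslope g0 zeroC = 1%Z.
Proof.
rewrite (lslope_loc g0 [false; false] [false]) //; [exact: isV_g0|exact: (prefix_zero 2)|exact: g0_00].
Qed.

Lemma loc_zero v : isV v -> v zeroC = zeroC -> exists a b,
  loc v (repeat false a) (repeat false b) /\ lslope v zeroC = (Z.of_nat a - Z.of_nat b)%Z.
Proof.
move=> H E. have [m [m' [P L]]] := isV_locally_affine _ H zeroC.
have P' : prefix m' zeroC by rewrite -E (prefixP _ _ P) L; apply: prefix_app.
exists (length m), (length m'). rewrite -(prefix_zero_repeat _ P) -(prefix_zero_repeat _ P').
split=> //. exact: lslope_loc.
Qed.

(** * Integer powers *)

Section GroupTheory.
Variables (Gm : Grp) (HGm : group_axioms Gm).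
Local Notation T := (car Gm).
Local Notation e := (gone Gm).
Local Notation inv := (ginv Gm).
Local Infix "*" := (gmul Gm).

Lemma mulA (a b c : T) : a * (b * c) = (a * b) * c. Proof. exact: (proj1 HGm). Qed.
Lemma mul1g (a : T) : e * a = a. Proof. by case: HGm => _ []. Qed.
Lemma mulg1 (a : T) : a * e = a. Proof. by case: HGm => _ [_ []]. Qed.
Lemma mulVg (a : T) : inv a * a = e. Proof. by case: HGm => _ [_ [_ []]]. Qed.
Lemma mulgV (a : T) : a * inv a = e. Proof. by case: HGm => _ [_ [_ []]]. Qed.
Lemma mulKg (a b : T) : inv a * (a * b) = b. Proof. by rewrite mulA mulVg mul1g. Qed.
Lemma mulKVg (a b : T) : a * (inv a * b) = b. Proof. by rewrite mulA mulgV mul1g. Qed.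
Lemma mulgI (a b c : T) : a * b = a * c -> b = c.
Proof. move=> E. by rewrite -(mulKg a b) E mulKg. Qed.
Lemma mulIg (a b c : T) : b * a = c * a -> b = c.
Proof. move=> E. by rewrite -(mulg1 b) -(mulgV a) mulA E -mulA mulgV mulg1. Qed.
Lemma inv_eq (a b : T) : a * b = e -> inv a = b.
Proof. move=> E. apply: (mulgI a). by rewrite mulgV E. Qed.
Lemma invM (a b : T) : inv (a * b) = inv b * inv a.
Proof. apply: inv_eq. by rewrite -mulA mulKVg mulgV. Qed.
Lemma invK (a : T) : inv (inv a) = a. Proof. apply: inv_eq. exact: mulVg. Qed.
Lemma inv1 : inv e = e. Proof. apply: inv_eq. exact: mulg1. Qed.
Lemma idem1 (a : T) : a * a = a -> a = e.
Proof. move=> E. apply: (mulgI a). by rewrite E mulg1. Qed.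

Lemma zpow_succ (g : T) k : zpow Gm g (k + 1) = g * zpow Gm g k.
Proof.
case: k => [|p|p].
- done.
- by rewrite -Pos2Z.inj_add Pos.add_1_r /zpow Pos2Nat.inj_succ.
- case: (Pos.succ_pred_or p) => [->|E].
    by rewrite /= mulg1 mulgV.
  rewrite -{1}E. have -> : (Z.neg (Pos.succ (Pos.pred p)) + 1 = Z.neg (Pos.pred p))%Z by lia.
  by rewrite -{2}E /zpow Pos2Nat.inj_succ /= mulKVg.
Qed.

Lemma zpow_1 (g : T) : zpow Gm g 1 = g. Proof. by rewrite /= mulg1. Qed.

Lemma zpow_add (g : T) j k : zpow Gm g (j + k) = zpow Gm g j * zpow Gm g k.
Proof.
elim/Z.peano_ind: j => [|j IH|j IH].
- by rewrite Z.add_0_l mul1g.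
- have -> : (Z.succ j + k = j + k + 1)%Z by lia.
  by rewrite -Z.add_1_r !zpow_succ IH mulA.
- apply: (mulgI g). rewrite mulA -!zpow_succ.
  have -> : (Z.pred j + k + 1 = j + k)%Z by lia.
  by have -> : (Z.pred j + 1 = j)%Z by lia.
Qed.

Lemma zpow_opp (g : T) k : zpow Gm g (- k) = inv (zpow Gm g k).
Proof. symmetry. apply: inv_eq. by rewrite -zpow_add Z.add_opp_diag_r. Qed.

Lemma central1 : central Gm e. Proof. move=> h. by rewrite mul1g mulg1. Qed.

Lemma centralM a b : central Gm a -> central Gm b -> central Gm (a * b).
Proof. move=> A B h. by rewrite -mulA B mulA A -mulA. Qed.

Lemma centralV a : central Gm a -> central Gm (inv a).
Proof. move=> A h. apply: (mulgI a). by rewrite mulKVg mulA A -mulA mulgV mulg1. Qed.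

Lemma central_zpow z k : central Gm z -> central Gm (zpow Gm z k).
Proof.
move=> C. elim/Z.peano_ind: k => [|j IH|j IH].
- exact: central1.
- rewrite -Z.add_1_r zpow_succ. exact: centralM.
- have -> : zpow Gm z (Z.pred j) = inv z * zpow Gm z j.
    apply: (mulgI z). rewrite mulKVg -zpow_succ. f_equal. lia.
  by apply: centralM => //; apply: centralV.
Qed.

Lemma zpow_mul z w k : central Gm z -> zpow Gm (z * w) k = zpow Gm z k * zpow Gm w k.
Proof.
move=> C. elim/Z.peano_ind: k => [|j IH|j IH].
- by rewrite mul1g.
- rewrite -Z.add_1_r !zpow_succ IH -!mulA. f_equal.
  by rewrite mulA -(central_zpow z j C w) mulA.
- apply: (mulgI (z * w)). rewrite -zpow_succ.
  have -> : (Z.pred j + 1 = j)%Z by lia.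
  rewrite IH -mulA (mulA w) -(central_zpow z _ C w) -!mulA -zpow_succ mulA -zpow_succ.
  by have -> : (Z.pred j + 1 = j)%Z by lia.
Qed.

Lemma zpow_e k : zpow Gm e k = e.
Proof. elim/Z.peano_ind: k => [//|j IH|j IH].
- by rewrite -Z.add_1_r zpow_succ IH mul1g.
- rewrite -[LHS]mul1g -zpow_succ -[RHS]IH. f_equal; lia.
Qed.

Lemma aut1 b : isAutGamma Gm b -> b e = e.
Proof. move=> [M _]. apply: idem1. by rewrite -M mul1g. Qed.

Lemma autV b a : isAutGamma Gm b -> b (inv a) = inv (b a).
Proof. move=> A. symmetry. apply: inv_eq. by rewrite -(proj1 A) mulgV aut1. Qed.

Lemma aut_zpow b z k : isAutGamma Gm b -> b (zpow Gm z k) = zpow Gm (b z) k.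
Proof.
move=> A. elim/Z.peano_ind: k => [|j IH|j IH].
- exact: aut1.
- by rewrite -Z.add_1_r !zpow_succ (proj1 A) IH.
- apply: (mulgI (b z)). rewrite -(proj1 A) -!zpow_succ.
  by have -> : (Z.pred j + 1 = j)%Z by lia.
Qed.

Lemma aut_central b z : isAutGamma Gm b -> central Gm z -> central Gm (b z).
Proof. move=> [M [_ S]] C h. have [k <-] := S h. by rewrite -!M C. Qed.

(** * Homomorphisms from V to abelian groups *)

Lemma swap_sym m n : disj m n -> swap m n = swap n m.
Proof.
move=> D. have D' := disj_sym _ _ D. extensionality x.
case: (prefix_dec m x) => [/prefixP ->|H]; first by rewrite swap_l swap_r.
case: (prefix_dec n x) => [/prefixP ->|H']; first by rewrite swap_l swap_r.
by rewrite !swap_out.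
Qed.

Lemma swap_conj p q r : disj p q -> disj p r -> disj q r ->
  (fun x => swap q r (swap p q (swap q r x))) = swap p r.
Proof.
move=> Dpq Dpr Dqr.
have Dqp := disj_sym _ _ Dpq. have Drp := disj_sym _ _ Dpr. have Drq := disj_sym _ _ Dqr.
have Op := swap_loc_out q r p Dqp Drp.
extensionality x.
case: (prefix_dec p x) => [/prefixP ->|Hp].
  by rewrite Op !swap_l.
case: (prefix_dec q x) => [/prefixP ->|Hq].
  by rewrite swap_l (swap_loc_out p q r) // swap_r // swap_loc_out.
case: (prefix_dec r x) => [/prefixP ->|Hr].
  by rewrite swap_r // swap_r // Op swap_r.
by rewrite (swap_out q r) // (swap_out p q) // !swap_out.
Qed.

Lemma disj_01 m : disj (m ++ [false]) (m ++ [true]).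
Proof. apply: disj_sub. exact: disj_cons. Qed.

Lemma swap_split m n : disj m n ->
  swap m n = (fun x => swap (m ++ [false]) (n ++ [false]) (swap (m ++ [true]) (n ++ [true]) x)).
Proof.
move=> D. have D' := disj_sym _ _ D.
have E p b z : (p ++ [b]) ^^ z = p ^^ [b] ^^ z by rewrite app_word_app.
have D01 := disj_01. have D10 p := disj_sym _ _ (D01 p).
extensionality x.
case: (prefix_dec m x) => [/prefixP ->|Hm].
  rewrite swap_l (digit_split (drop (length m) x)) -!E. case: (drop (length m) x 0).
    rewrite swap_l swap_loc_out //. exact: disj_app.
  rewrite (swap_loc_out (m ++ [true])) // ?swap_l //. exact: disj_app.
case: (prefix_dec n x) => [/prefixP ->|Hn].
  rewrite swap_r // (digit_split (drop (length n) x)) -!E. case: (drop (length n) x 0).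
    rewrite swap_r; first exact: disj_app. rewrite swap_loc_out //. exact: disj_app.
  rewrite (swap_loc_out (m ++ [true])) // ?swap_r //; exact: disj_app.
by rewrite !swap_out // => /prefix_app_split.
Qed.

(** * Tilings of Cantor space by cones *)

Definition ind x m := if prefix_dec m x then 1 else 0.
Definition cover_count x ms := list_sum (map (ind x) ms).
(** Counting the leaves through each point makes the condition invariant under permutation, additive
    when a leaf is split, and false for lists with repetitions. *)
Definition tiling ms := forall x, cover_count x ms = 1.

Lemma cover_count_perm x ms ns : Permutation ms ns -> cover_count x ms = cover_count x ns.
Proof. elim=> //=; rewrite /cover_count /=; lia. Qed.

Lemma ind_split x m : ind x m = ind x (m ++ [false]) + ind x (m ++ [true]).
Proof.
rewrite /ind. case: (prefix_dec m x) => P; last first.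
  by do 2 (case: prefix_dec => [/prefix_app_split //|_]).
have := prefixP _ _ P. set z := drop _ x. rewrite (digit_split z) => E.
have Q : prefix (m ++ [z 0]) x by rewrite E -app_word_app; apply: prefix_app.
have D := disj_01 m x. case: (z 0) Q => Q.
  case: prefix_dec => [R|_]; first by case: (D R Q). by case: prefix_dec.
case: prefix_dec => // _. case: prefix_dec => // R. by case: (D Q R).
Qed.

Lemma tiling_cover ms x : tiling ms -> exists m, In m ms /\ prefix m x.
Proof.
move/(_ x). rewrite /cover_count. elim: ms => [//|m ms IH] /=. rewrite {1}/ind.
case: prefix_dec => P /= H; first by exists m; split; [left|].
have [n [I Q]] := IH H. exists n. by split; [right|].
Qed.

Lemma ind_le_count x m ms : In m ms -> ind x m <= cover_count x ms.
Proof.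
rewrite /cover_count. elim: ms => [//|n ms IH] /= [->|/IH]; lia.
Qed.

Lemma tiling_disj ms m n : tiling ms -> In m ms -> In n ms -> m <> n -> disj m n.
Proof.
move=> Ht Hm Hn ne x P Q. have [l1 [l2 E]] := in_split _ _ Hm.
have Hp : Permutation ms (m :: l1 ++ l2) by rewrite E; symmetry; apply: Permutation_middle.
have I : In n (l1 ++ l2) by case: (Permutation_in _ Hp Hn).
have := Ht x. rewrite (cover_count_perm _ _ _ Hp) /cover_count /= -/(cover_count _ _).
have := ind_le_count x _ _ I. rewrite /ind. do 2 case: prefix_dec => //. lia.
Qed.

Lemma longest (W : list (list bool)) : W <> [] ->
  exists w, In w W /\ forall n, In n W -> length n <= length w.
Proof.
elim: W => [//|w W IH] _. case: W IH => [_|u W IH].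
  exists w. split; first by left. by move=> n [<-|[]].
have [//|z [Iz Hz]] := IH. case: (Nat.le_ge_cases (length z) (length w)) => L.
  exists w. split; first by left. move=> n [<-//|/Hz]. lia.
exists z. split; first by right. by move=> n [<-//|/Hz].
Qed.

(** A leaf of maximal length has its sibling as a leaf: the leaf through a point of the sibling cone
    cannot be shorter, since it would meet the chosen leaf, nor longer, by maximality. *)
Lemma caret W : (forall x, exists m, In m W /\ prefix m x) ->
  (forall m n, In m W -> In n W -> m <> n -> disj m n) -> ~ In [] W ->
  exists m, In (m ++ [false]) W /\ In (m ++ [true]) W.
Proof.
move=> C D N.
have ne : W <> [] by move=> E; have [m [I _]] := C zeroC; rewrite E in I.
have [w [Iw Hw]] := longest _ ne.
have [m [b Ew]] : exists m b, w = m ++ [b].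
  have nw : w <> [] by move=> E; apply: N; rewrite -E.
  have [m [b E]] := exists_last nw. by exists m, b.
subst w. set s := m ++ [negb b]. have [n [In_ Pn]] := C (s ^^ zeroC).
have Ls : length s = S (length m) by rewrite length_app /=; lia.
have Lw : length (m ++ [b]) = S (length m) by rewrite length_app /=; lia.
have En : n = s.
  case: (Nat.le_gt_cases (length n) (length m)) => L.
    have [t Et] : exists t, m = n ++ t.
      apply: (prefix_nested _ _ (s ^^ zeroC)) => //. rewrite /s app_word_app. exact: prefix_app.
    have nw : n <> m ++ [b] by move=> E; move: L; rewrite E Lw; lia.
    case: (D _ _ In_ Iw nw (n ^^ t ^^ [b] ^^ zeroC)); first exact: prefix_app.
    rewrite Et -!app_word_app. exact: prefix_app.
  have Ln : length n = length s by have := Hw _ In_; lia.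
  move/prefix_pre: Pn. by rewrite Ln pre_app.
rewrite En /s in In_. exists m. by case: (b) Iw In_.
Qed.

Lemma loc_nil v m : bij v -> loc v [] m -> m = [].
Proof.
move=> B L. case: m L => // b s L.
have := L (finv v (fun _ => negb b)). rewrite app_word_nil finv_r // => /(f_equal (fun f => f 0)).
rewrite app_word_lt /=; [lia|]. by case: b {L}.
Qed.

Lemma loc_nil_id v m : bij v -> loc v [] m -> v = (fun x => x).
Proof.
move=> B L. have E := loc_nil _ _ B L. subst m. extensionality x.
by have := L x; rewrite !app_word_nil.
Qed.

Section Perfect.
Variable chi : (Cantor -> Cantor) -> T.
Hypothesis chiM : forall v w, isV v -> isV w -> chi (fun x => v (w x)) = chi v * chi w.
Hypothesis chiC : forall v w, isV v -> isV w -> chi v * chi w = chi w * chi v.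

Lemma chi_id : chi (fun x => x) = e.
Proof. apply: idem1. by rewrite -chiM //; apply: isV_id. Qed.

Lemma chi_swap_sq m n : disj m n -> chi (swap m n) * chi (swap m n) = e.
Proof.
move=> D. have S := isV_swap _ _ D. rewrite -chiM // -chi_id. f_equal.
extensionality x. exact: swap_invol.
Qed.

Lemma chi_swap_conj p q r : disj p q -> disj p r -> disj q r -> chi (swap p q) = chi (swap p r).
Proof.
move=> Dpq Dpr Dqr. have S := isV_swap _ _ Dqr. have S' := isV_swap _ _ Dpq.
rewrite -(swap_conj p q r) // (chiM _ (fun x => swap p q (swap q r x))) //; first exact: isV_comp.
by rewrite (chiM (swap p q) (swap q r)) // (chiC (swap p q) (swap q r)) // mulA chi_swap_sq // mul1g.
Qed.

(* The two halves of a swap are conjugate involutions. *)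
Lemma chi_swap m n : disj m n -> chi (swap m n) = e.
Proof.
move=> D.
have D' b c : disj (m ++ [b]) (n ++ [c]) by apply: disj_app.
rewrite swap_split // chiM; try exact: isV_swap.
rewrite (chi_swap_conj (m ++ [false]) _ (n ++ [true])) //; first exact: disj_01.
rewrite swap_sym // (chi_swap_conj (n ++ [true]) _ (m ++ [true])); try exact: disj_sym.
  exact: disj_01.
rewrite swap_sym; first exact: disj_sym.
exact: chi_swap_sq.
Qed.

Definition affine_on v ms := forall m, In m ms -> exists m', loc v m m'.

Lemma leaf_exchange v ms p q a : isV v -> tiling ms -> affine_on v ms -> In p ms -> In q ms ->
  loc v q a -> exists v', isV v' /\ chi v' = chi v /\ affine_on v' ms /\ loc v' p a /\
    (forall r b, In r ms -> r <> q -> loc v r b -> exists r', In r' ms /\ r' <> p /\ loc v' r' b) /\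
    (forall r b, In r ms -> r <> p -> r <> q -> loc v r b -> loc v' r b).
Proof.
move=> Hv Ht A Ip Iq L. case: (excluded_middle_informative (p = q)) => [E|ne].
  subst q. exists v. do 4 (split=> //). split=> // r b Ir nr Lr. by exists r.
have D := tiling_disj _ _ _ Ht Ip Iq ne. have S := isV_swap _ _ D.
have Out r b : In r ms -> r <> p -> r <> q -> loc v r b -> loc (fun x => v (swap p q x)) r b.
  move=> Ir np nq Lr z. rewrite swap_loc_out; last exact: Lr.
    by apply: (tiling_disj ms) => //; apply: not_eq_sym.
  by apply: (tiling_disj ms) => //; apply: not_eq_sym.
have Lq b : loc v p b -> loc (fun x => v (swap p q x)) q b.
  by move=> Lp z; rewrite swap_r // Lp.
exists (fun x => v (swap p q x)). split; first exact: isV_comp.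
split; first by rewrite chiM // chi_swap // mulg1.
split; [|split; [|split]] => //.
- move=> m Im. have [b Lb] := A m Im.
  case: (excluded_middle_informative (m = p)) => [->|np].
    by exists a => z; rewrite swap_l L.
  case: (excluded_middle_informative (m = q)) => [->|nq].
    by have [c Lc] := A p Ip; exists c; apply: Lq.
  exists b. exact: Out.
- by move=> z; rewrite swap_l L.
- move=> r b Ir nq Lr. case: (excluded_middle_informative (r = p)) => [E|np].
    subst r. exists q. split=> //. split; [exact: not_eq_sym|exact: Lq].
  exists r. by do 2 (split=> //); apply: Out.
Qed.

(* Precomposing with swaps of leaves makes a caret of the domain tree map to a
   caret of the range tree, which lets both be collapsed. *)
Lemma chi_trivial_leaves n ms v : length ms <= n -> isV v -> tiling ms -> affine_on v ms -> chi v = e.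
Proof.
elim: n ms v => [|n IH] ms v Ln Hv Ht A.
  have [m [I _]] := tiling_cover _ zeroC Ht. by case: ms Ln I {Ht A} => //= *; lia.
have B := isV_bij _ Hv.
case: (excluded_middle_informative (In [] ms)) => [I|N].
  have [m' L] := A _ I. by rewrite (loc_nil_id _ _ B L) chi_id.
pose im m := epsilon (inhabits nil) (fun m' => loc v m m').
have Him m : In m ms -> loc v m (im m) by move=> I; exact: (epsilon_spec _ _ (A m I)).
have [m [I0 I1]] := caret ms (fun x => tiling_cover _ x Ht) (fun m n => tiling_disj ms m n Ht) N.
have [k [J0 J1]] : exists k, In (k ++ [false]) (map im ms) /\ In (k ++ [true]) (map im ms).
{ apply: caret.
  - move=> x. have [q [Iq Pq]] := tiling_cover _ (finv v x) Ht.
    exists (im q). split; first exact: in_map.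
    rewrite -(finv_r v x B) (prefixP _ _ Pq) (Him _ Iq). exact: prefix_app.
  - move=> a b /in_map_iff [p [<- Ip]] /in_map_iff [q [<- Iq]] ne x /prefixP Pa /prefixP.
    rewrite {1}Pa -Him // -Him // => /(bij_inj _ _ _ B) E.
    have npq : p <> q by move=> Epq; apply: ne; rewrite Epq.
    apply: (tiling_disj _ _ _ Ht Ip Iq npq (p ^^ drop (length (im p)) x)); first exact: prefix_app.
    rewrite E. exact: prefix_app.
  - move/in_map_iff => [p [E Ip]]. apply: N.
    have L := loc_finv _ _ _ B (Him _ Ip). rewrite E in L.
    by rewrite -(loc_nil _ _ (finv_bij _ B) L). }
move/in_map_iff: J0 => [p0 [E0 Ip0]]. move/in_map_iff: J1 => [p1 [E1 Ip1]].
have L0 := Him _ Ip0. have L1 := Him _ Ip1. rewrite E0 in L0. rewrite E1 in L1.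
have n01 : p1 <> p0.
  move=> E. rewrite E in E1. by case: (app_inj_tail _ _ _ _ (eq_trans (eq_sym E0) E1)).
have nm : m ++ [false] <> m ++ [true] by move=> E; case: (app_inj_tail _ _ _ _ E).
have [v1 [V1 [X1 [A1 [L1' [R1 _]]]]]] := leaf_exchange v ms _ _ _ Hv Ht A I0 Ip0 L0.
(* The first exchange may have displaced the leaf with image [k ++ [true]]. Its present position [r]
   differs from [m ++ [false]], so the second exchange does not undo the first. *)
have [r [Ir [nr Lr]]] := R1 _ _ Ip1 n01 L1.
have [v2 [V2 [X2 [A2 [L2' [_ R2]]]]]] := leaf_exchange v1 ms _ _ _ V1 Ht A1 I1 Ir Lr.
have L2 := R2 _ _ I0 nm (not_eq_sym nr) L1'.
rewrite -X1 -X2.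
have [l1 [l2 E]] := in_split _ _ I0.
have P1 : Permutation ms ((m ++ [false]) :: l1 ++ l2).
  by rewrite E; symmetry; apply: Permutation_middle.
have I1' : In (m ++ [true]) (l1 ++ l2) by case: (Permutation_in _ P1 I1).
have [l3 [l4 E']] := in_split _ _ I1'.
have P2 : Permutation ms ((m ++ [false]) :: (m ++ [true]) :: l3 ++ l4).
  rewrite P1. constructor. by rewrite E'; symmetry; apply: Permutation_middle.
apply: (IH (m :: l3 ++ l4)) => //.
- move: Ln. rewrite (Permutation_length P2) /=. lia.
- move=> x. move: (Ht x). rewrite (cover_count_perm _ _ _ P2) /cover_count /= (ind_split x m). lia.
- move=> q [<-|Iq].
    exists k => z. rewrite (digit_split z) -!app_word_app. by case: (z 0); rewrite ?L2 ?L2'.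
  apply: A2. apply: (Permutation_in _ (Permutation_sym P2)). by right; right.
Qed.

Lemma tiling_words n : tiling (words n).
Proof.
elim: n => [|n IH] x.
  rewrite /cover_count /= /ind. case: prefix_dec => // -[]. move=> i /=. lia.
move: (IH (drop 1 x)). rewrite /cover_count /= map_app list_sum_app !map_map.
have E b : forall l, list_sum (map (fun m => ind x (b :: m)) l) =
    if excluded_middle_informative (x 0 = b) then list_sum (map (ind (drop 1 x)) l) else 0.
  have Eb m : ind x (b :: m) = if excluded_middle_informative (x 0 = b) then ind (drop 1 x) m else 0.
    rewrite /ind. case: excluded_middle_informative => [Eb|Nb].
      have Q : prefix (b :: m) x <-> prefix m (drop 1 x).
        rewrite {1}(digit_split x) Eb. exact: (prefix_app_app [b] m).
      do 2 case: prefix_dec => //; tauto.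
    case: prefix_dec => // P. case: Nb. exact: (P 0 ltac:(simpl; lia)).
  elim=> [|m l IHl] /=; first by case: excluded_middle_informative.
  rewrite IHl Eb. by case: excluded_middle_informative.
rewrite !E. do 2 case: excluded_middle_informative; case: (x 0) => //; lia.
Qed.

Lemma chi_trivial v : isV v -> chi v = e.
Proof.
move=> H. have [n U] := locally_affine_unif _ (isV_locally_affine _ H).
apply: (chi_trivial_leaves (length (words n)) (words n)) => //; first exact: tiling_words.
move=> m /in_words. exact: U.
Qed.

End Perfect.
End GroupTheory.

(** * Characters of the stabiliser of 0 *)

(** An embedding of V into the elements that fix a whole neighbourhood of 0; homomorphisms of the
    stabiliser with commuting values die on it by perfectness. *)
Definition lift (u : Cantor -> Cantor) : Cantor -> Cantor :=
  fun x => if x 0 then [true] ^^ u (drop 1 x) else x.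

Lemma lift_1 u y : lift u ([true] ^^ y) = [true] ^^ u y.
Proof. by rewrite /lift app_word_lt /=; [lia|]; rewrite (drop_app [true]). Qed.

Lemma lift_0 u y : lift u ([false] ^^ y) = [false] ^^ y.
Proof. by rewrite /lift app_word_lt /=; [lia|]. Qed.

Lemma lift_comp u w : lift (fun x => u (w x)) = (fun x => lift u (lift w x)).
Proof.
extensionality x. rewrite (digit_split x). case: (x 0); by rewrite ?lift_1 ?lift_0 ?lift_1 ?lift_0.
Qed.

Lemma isV_lift u : isV u -> isV (lift u).
Proof.
move=> H. have B := isV_bij _ H. apply: isV_intro.
  exists (lift (finv u)); split=> x; rewrite (digit_split x); case: (x 0);
    by rewrite ?lift_1 ?lift_0 ?lift_1 ?lift_0 ?finv_l ?finv_r.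
move=> x. rewrite (digit_split x). case: (x 0).
  have [m [m' [P L]]] := isV_locally_affine _ H (drop 1 x).
  exists (true :: m), (true :: m'). split.
    rewrite (prefixP _ _ P) -app_word_app. exact: prefix_app.
  move=> z. by rewrite (app_cons _ m) lift_1 L -app_cons.
exists [false], [false]. split; [exact: prefix_app|exact: lift_0].
Qed.

Lemma fixes_half_lift w : isV w -> loc w [false] [false] -> exists u, isV u /\ w = lift u.
Proof.
move=> H L0. have B := isV_bij _ H.
have W1 x : w ([true] ^^ x) 0 = true.
  case E: (w ([true] ^^ x) 0) => //. have := digit_split (w ([true] ^^ x)).
  rewrite E -L0 => /(bij_inj _ _ _ B) /(f_equal (fun f => f 0)).
  by rewrite !app_word_lt /=; try lia.
have W1' x : finv w ([true] ^^ x) 0 = true.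
  case E: (finv w ([true] ^^ x) 0) => //. have := digit_split (finv w ([true] ^^ x)).
  rewrite E => /(f_equal w). rewrite L0 finv_r // => /(f_equal (fun f => f 0)).
  by rewrite !app_word_lt /=; try lia.
pose u y := drop 1 (w ([true] ^^ y)). have Eu y : w ([true] ^^ y) = [true] ^^ u y.
  by rewrite {1}(digit_split (w _)) W1.
exists u. split; last first.
  extensionality x. rewrite (digit_split x). by case: (x 0); rewrite ?lift_1 ?lift_0.
apply: isV_intro.
  pose t y := drop 1 (finv w ([true] ^^ y)). have Et y : finv w ([true] ^^ y) = [true] ^^ t y.
    by rewrite {1}(digit_split (finv w _)) W1'.
  exists t. split=> x; apply: (app_word_inj [true]).
    by rewrite -Et -Eu finv_l.
  by rewrite -Eu -Et finv_r.
move=> y. have [m [m' [P L]]] := isV_locally_affine _ H ([true] ^^ y).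
(* One more digit makes both the domain word and the image word nonempty, so that a leading [true]
   can be stripped from each. *)
pose s := pre (drop (length m) ([true] ^^ y)) 1.
have P2 : prefix (m ++ s) ([true] ^^ y).
  rewrite {1}(prefixP _ _ P). apply/prefix_app_app. exact: prefix_pre_self.
have L2 := loc_ext _ _ _ s L.
have Ls : length s = 1 by rewrite pre_length.
case Em: (m ++ s) P2 L2 => [|b n] P2 L2.
  by move/(f_equal (@length bool)): Em; rewrite length_app Ls; simpl; lia.
have Eb : b = true.
  have := P2 0 ltac:(simpl; lia). by rewrite app_word_lt /=; [lia|].
subst b.
have Pn : prefix n y by apply/(prefix_app_app [true]).
case Em': (m' ++ s) L2 => [|b n'] L2.
  by move/(f_equal (@length bool)): Em'; rewrite length_app Ls; simpl; lia.
have Eb : b = true.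
  have := W1 (n ^^ zeroC). rewrite -app_cons L2 app_word_lt /=; [lia|]. done.
subst b. exists n, n'. split=> // z. apply: (app_word_inj [true]).
by rewrite -Eu -!app_cons L2.
Qed.

Section StabHom.
Variables (Gm : Grp) (HGm : group_axioms Gm).
Local Notation T := (car Gm).
Local Notation e := (gone Gm).
Local Infix "*" := (gmul Gm).
Variable chi : (Cantor -> Cantor) -> T.
Definition stab0 v := isV v /\ v zeroC = zeroC.
Hypothesis chiM : forall v w, stab0 v -> stab0 w -> chi (fun x => v (w x)) = chi v * chi w.

Lemma stab0_comp v w : stab0 v -> stab0 w -> stab0 (fun x => v (w x)).
Proof. move=> [Hv Ev] [Hw Ew]. split; [exact: isV_comp|by rewrite Ew]. Qed.

Lemma stab0_finv v : stab0 v -> stab0 (finv v).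
Proof. move=> [Hv Ev]. split; [exact: isV_finv|apply: finv_eq => //; exact: isV_bij]. Qed.

Lemma stab0_id : stab0 (fun x => x).
Proof. split=> //. exact: isV_id. Qed.

Lemma stab0_g0 : stab0 g0.
Proof. split; [exact: isV_g0|exact: g0_zero]. Qed.

Lemma stab_hom_id : chi (fun x => x) = e.
Proof. apply: (idem1 _ HGm). by rewrite -chiM //; apply: stab0_id. Qed.

Lemma stab_hom_finv v : stab0 v -> chi v * chi (finv v) = e.
Proof.
move=> S. rewrite -chiM //; first exact: stab0_finv. rewrite -stab_hom_id. f_equal.
extensionality x. apply: finv_r. exact: isV_bij (proj1 S).
Qed.

(** [g0] has log-slope 1 at 0, so factors [g0^-1] reduce a nonnegative log-slope to 0; negative ones
    follow by inversion. Triviality at log-slope 0 is left as a hypothesis because it has two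
    sources: perfectness of V in [stab_hom_kill] and continuity in [conjV_slope_kill]. *)
Lemma stab_hom_pow : (forall v, stab0 v -> lslope v zeroC = 0%Z -> chi v = e) ->
  forall v, stab0 v -> chi v = zpow Gm (chi g0) (lslope v zeroC).
Proof.
move=> kill.
have pos : forall n v, stab0 v -> lslope v zeroC = Z.of_nat n -> chi v = zpow Gm (chi g0) (Z.of_nat n).
  elim=> [|n IH] v S E; first exact: kill.
  have S' := stab0_finv _ stab0_g0. pose w x := v (finv g0 x).
  have Sw : stab0 w by apply: stab0_comp.
  have -> : v = (fun x => w (g0 x)).
    extensionality x. rewrite /w finv_l //. exact: g0_bij.
  rewrite chiM //; first exact: stab0_g0.
  rewrite (IH w) //.
    rewrite lslope_comp; [exact: (proj1 S)|exact: (proj1 S')|].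
    rewrite (proj2 S') E -{1}g0_zero lslope_finv; first exact: isV_g0. rewrite lslope_g0. lia.
  by rewrite -{2}(zpow_1 _ HGm (chi g0)) -zpow_add //; f_equal; lia.
move=> v S. case: (Z.le_ge_cases 0 (lslope v zeroC)) => L.
  rewrite (pos (Z.to_nat (lslope v zeroC)) v) ?Z2Nat.id //.
have S' := stab0_finv _ S.
have E' : lslope (finv v) zeroC = (- lslope v zeroC)%Z.
  by rewrite -{1}(proj2 S) lslope_finv //; case: S.
have E := pos (Z.to_nat (- lslope v zeroC)) (finv v) S'.
rewrite Z2Nat.id in E; [lia|]. have {}E := E E'.
rewrite zpow_opp // in E. rewrite -(invK _ HGm (zpow _ _ _)) -E. symmetry.
apply: inv_eq => //. have F := stab_hom_finv _ S'. by rewrite finv_finv in F; [exact: isV_bij (proj1 S)|].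
Qed.

(* Conjugating by powers of [g0], an element fixing a neighbourhood of 0 becomes
   one supported in the cone of [1], where perfectness of V applies. *)
Lemma stab_hom_kill : (forall v w, stab0 v -> stab0 w -> chi v * chi w = chi w * chi v) ->
  forall v, stab0 v -> lslope v zeroC = 0%Z -> chi v = e.
Proof.
move=> chiC v Sv E.
have S0 u : isV u -> stab0 (lift u) by move=> H; split; [exact: isV_lift|].
have K u : isV u -> chi (lift u) = e.
  apply: (chi_trivial Gm HGm (fun u => chi (lift u))) => v' w' V W.
    by rewrite lift_comp chiM //; apply: S0.
  by apply: chiC; apply: S0.
have KK : forall a w, stab0 w -> loc w (repeat false (S a)) (repeat false (S a)) -> chi w = e.
  elim=> [|a IH] w Sw L.
    have [u [Hu ->]] := fixes_half_lift w (proj1 Sw) L. exact: K.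
  have Sg := stab0_g0. have Sg' := stab0_finv _ Sg.
  have Sc : stab0 (fun x => g0 (w (finv g0 x))).
    by apply: (stab0_comp g0 (fun x => w (finv g0 x))) => //; apply: stab0_comp.
  have := IH _ Sc. rewrite (chiM g0 (fun x => w (finv g0 x))) //; first exact: stab0_comp.
  rewrite (chiM w (finv g0)) // (chiC w (finv g0)) // (mulA _ HGm) stab_hom_finv // mul1g //.
  apply=> z. rewrite -[repeat _ _]/([false] ++ repeat false a) app_word_app.
  rewrite (loc_finv _ _ _ g0_bij g0_00) -app_word_app.
  rewrite -[[_; _] ++ _]/(repeat false (S (S a))) L.
  by rewrite -[repeat _ _]/([false; false] ++ repeat false a) app_word_app g0_00.
have [a [b [L Es]]] := loc_zero v (proj1 Sv) (proj2 Sv).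
have Eab : b = a by lia. subst b. apply: (KK a) => //.
(* The cone at 0 fixed by [v] may be the whole space; one more zero gives its word the positive
   length required by [KK]. *)
rewrite -Nat.add_1_r repeat_app. exact: loc_ext.
Qed.

End StabHom.

(** * Conjugation by the normaliser preserves slopes at fixed points *)

Definition conjV (phi w : Cantor -> Cantor) : Cantor -> Cantor := fun y => finv phi (w (phi y)).

Lemma homeo_bij f : homeoC f -> bij f.
Proof. move=> [_ [g [H [H' _]]]]. by exists g. Qed.

Lemma homeo_finv_cont f : homeoC f -> contC (finv f).
Proof. move=> [_ [g [H [H' C]]]]. by rewrite (finv_uniq f g). Qed.

Section Normaliser.
Variable phi : Cantor -> Cantor.
Hypothesis Sphi : inStab phi.

Lemma stab_bij : bij phi.
Proof. exact: homeo_bij (proj1 Sphi). Qed.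

Lemma stab_inQ2 x : inQ2 x <-> inQ2 (phi x).
Proof. by case: Sphi => _ [_ [_ H]]. Qed.

Lemma stab_inQ2_finv x : inQ2 x <-> inQ2 (finv phi x).
Proof. rewrite (stab_inQ2 (finv phi x)) finv_r //. exact: stab_bij. Qed.

Lemma stab_conj_isV v : isV v -> isV (fun x => phi (v (finv phi x))).
Proof. case: Sphi => _ [H _]. exact: H. Qed.

Lemma stab_conjV_isV w : isV w -> isV (conjV phi w).
Proof.
case: (Sphi) => _ [_ [H _]] Hw. have [v [Hv E]] := H w Hw.
have -> // : conjV phi w = v. extensionality y. rewrite /conjV E !finv_l //; exact: stab_bij.
Qed.

Lemma conjV_comp v w : conjV phi (fun x => v (w x)) = (fun x => conjV phi v (conjV phi w x)).
Proof. extensionality y. by rewrite /conjV finv_r //; apply: stab_bij. Qed.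

Lemma conjV_fixed v x : v x = x -> conjV phi v (finv phi x) = finv phi x.
Proof. move=> E. rewrite /conjV finv_r ?E //. exact: stab_bij. Qed.

End Normaliser.

Lemma inStab_comp phi psi : inStab phi -> inStab psi -> inStab (fun x => phi (psi x)).
Proof.
move=> S1 S2. have B1 := stab_bij _ S1. have B2 := stab_bij _ S2.
split; [|split; [|split]].
- split; first exact: contC_comp (proj1 (proj1 S1)) (proj1 (proj1 S2)).
  exists (finv (fun x => phi (psi x))).
  have B := bij_comp _ _ B1 B2.
  split; first by move=> x; exact: (finv_l _ x B). split; first by move=> x; exact: (finv_r _ x B).
  rewrite finv_comp //. exact: contC_comp (homeo_finv_cont _ (proj1 S2)) (homeo_finv_cont _ (proj1 S1)).
- move=> v Hv. rewrite finv_comp //.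
  exact: (stab_conj_isV _ S1 _ (stab_conj_isV _ S2 _ Hv)).
- move=> w Hw. exists (conjV psi (conjV phi w)). split.
    by do 2 apply: stab_conjV_isV => //.
  move=> x. by rewrite finv_comp // /conjV !finv_r.
- move=> x. by rewrite (stab_inQ2 _ S2) (stab_inQ2 _ S1).
Qed.

Lemma inStab_isV u : isV u -> inStab u.
Proof.
move=> H. have B := isV_bij _ H. have H' := isV_finv _ H. split; [|split; [|split]].
- split; first exact: isV_cont. exists (finv u).
  split; first by move=> x; exact: (finv_l _ x B). split; first by move=> x; exact: (finv_r _ x B).
  exact: isV_cont.
- move=> v Hv. apply: (isV_comp u (fun x => v (finv u x))) => //. exact: isV_comp.
- move=> w Hw. exists (fun x => finv u (w (u x))). split.
    apply: (isV_comp (finv u) (fun x => w (u x))) => //. exact: isV_comp.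
  move=> x. by rewrite !finv_r.
- move=> x. exact: inQ2_isV.
Qed.

Lemma inStab_finv phi : inStab phi -> inStab (finv phi).
Proof.
move=> S. have B := stab_bij _ S. split; [|split; [|split]].
- split; first exact: homeo_finv_cont (proj1 S). exists phi.
  split; first by move=> x; exact: (finv_r _ x B).
  split; first by move=> x; exact: (finv_l _ x B).
  exact: (proj1 (proj1 S)).
- move=> v Hv. rewrite finv_finv //. exact: stab_conjV_isV.
- move=> w Hw. exists (fun x => phi (w (finv phi x))). split; first exact: (stab_conj_isV _ S _ Hw).
  move=> x. by rewrite finv_finv // !finv_l.
- move=> x. exact: (stab_inQ2_finv _ S).
Qed.

(** The integers as a target group: the log-slope of a conjugate is a homomorphism on the stabiliser
    of 0, to which [stab_hom_pow] is applied. *)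
Definition Zgrp : Grp := {| car := Z; gmul := Z.add; ginv := Z.opp; gone := 0%Z |}.

Lemma Zgrp_axioms : group_axioms Zgrp.
Proof. repeat split; simpl; intros; lia. Qed.

Lemma Zgrp_zpow (a k : Z) : zpow Zgrp a k = (a * k)%Z.
Proof.
elim/Z.peano_ind: k => [|k IH|k IH].
- rewrite /=. lia.
- rewrite -Z.add_1_r (zpow_succ _ Zgrp_axioms) /= IH. lia.
- have := zpow_succ _ Zgrp_axioms a (Z.pred k). have -> : (Z.pred k + 1 = k)%Z by lia.
  rewrite IH. change (gmul Zgrp) with Z.add. lia.
Qed.

Lemma zeros_split k y : (forall i, i < k -> y i = false) -> y = repeat false k ^^ drop k y.
Proof.
move=> H. rewrite -{1}(app_pre_drop y k). f_equal.
apply: (nth_ext _ _ false false); rewrite pre_length ?repeat_length // => i Hi.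
by rewrite nth_pre // H // nth_repeat.
Qed.

Lemma zeros_app a b x : repeat false (a + b) ^^ x = repeat false a ^^ repeat false b ^^ x.
Proof. by rewrite repeat_app app_word_app. Qed.

Lemma bij_iter t n : bij t -> bij (Nat.iter n t).
Proof. move=> B. elim: n => [|n IH] /=; [exact: bij_id|exact: bij_comp]. Qed.

(** Each application removes one leading zero. The bound [b <= k] guarantees that at least [S b]
    zeros are present before every application, as the local formula for [t] requires. *)
Lemma expanding_iter t b : loc t (repeat false (S b)) (repeat false b) ->
  forall n k x, b <= k -> Nat.iter n t (repeat false (k + n) ^^ x) = repeat false k ^^ x.
Proof.
move=> L. elim=> [|n IH] k x Hk; first by rewrite Nat.add_0_r.
rewrite /= -Nat.add_succ_comm IH; [lia|].
have -> : S k = S b + (k - b) by lia.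
rewrite zeros_app L -zeros_app. f_equal. f_equal. lia.
Qed.

Lemma g0_inv_iter n z : Nat.iter n (finv g0) ([false] ^^ z) = repeat false (S n) ^^ z.
Proof.
elim: n => [//|n IH]. rewrite [LHS]/= IH -[repeat false (S n)]/([false] ++ repeat false n).
by rewrite app_word_app (loc_finv _ _ _ g0_bij g0_00) -app_word_app.
Qed.

Section FixedZero.
Variable phi : Cantor -> Cantor.
Hypothesis Sphi : inStab phi.
Hypothesis phi0 : phi zeroC = zeroC.

Lemma finv_phi0 : finv phi zeroC = zeroC.
Proof. apply: finv_eq => //. exact: stab_bij. Qed.

Lemma stab0_conjV s : stab0 s -> stab0 (conjV phi s).
Proof.
move=> [H E]. split; first exact: stab_conjV_isV.
by rewrite /conjV phi0 E finv_phi0.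
Qed.

(** Slope 0 means trivial on a cone at 0. By continuity [phi] carries a smaller cone into it, and on
    that smaller cone the conjugate is trivial. *)
Lemma conjV_slope_kill s : stab0 s -> lslope s zeroC = 0%Z -> lslope (conjV phi s) zeroC = 0%Z.
Proof.
move=> S E. have [a [b [L E']]] := loc_zero s (proj1 S) (proj2 S).
have Eab : b = a by lia. subst b.
have [c Hc] := proj1 (proj1 Sphi) zeroC a.
rewrite (lslope_loc _ (repeat false c) (repeat false c)); last lia;
  [exact: stab_conjV_isV (proj1 S)|exact: prefix_zero|].
move=> z. have -> // : conjV phi s (repeat false c ^^ z) = repeat false c ^^ z.
rewrite /conjV. set y := _ ^^ z.
have Ey : phi y = repeat false a ^^ drop a (phi y).
  apply: zeros_split => i Hi. rewrite Hc ?phi0 // => j Hj.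
  by rewrite /y app_word_lt ?repeat_length // nth_repeat.
rewrite Ey L -Ey finv_l //. exact: stab_bij.
Qed.

(* [t] cannot both expand at 0 and be conjugate to the contraction [g0^-1]. *)
Lemma conjV_g0_inv_not_expanding : lslope (conjV phi (finv g0)) zeroC <> 1%Z.
Proof.
move=> E1. set t := conjV phi (finv g0) in E1.
have St : stab0 t by apply: stab0_conjV; apply: stab0_finv; apply: stab0_g0.
have [a [b [L E]]] := loc_zero t (proj1 St) (proj2 St).
have Ea : a = S b by lia. subst a.
have [c Hc] := proj1 (proj1 Sphi) zeroC 1.
(* At least [c] zeros make [phi z] start with [false], and at least [b] make [expanding_iter]
   applicable. The digit [true] at index [A] is what fails: [t^n z] starts with [S A] zeros, so by
   injectivity of [t^n] the point [z] itself starts with [S A + n] zeros. *)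
pose A := b + c. pose z := repeat false A ^^ [true] ^^ zeroC.
have [n Hn] := homeo_finv_cont _ (proj1 Sphi) zeroC (S A).
have It k y : Nat.iter k t y = finv phi (Nat.iter k (finv g0) (phi y)).
  elim: k => [|k IH] /=; first by rewrite finv_l //; apply: stab_bij.
  by rewrite IH /t /conjV finv_r //; apply: stab_bij.
have Ez : phi z = [false] ^^ drop 1 (phi z).
  rewrite {1}(digit_split (phi z)). rewrite (Hc z) ?phi0 //.
  move=> i Hi. rewrite /z app_word_lt ?repeat_length ?nth_repeat //. lia.
have Ey : Nat.iter n t z = repeat false (S A) ^^ drop (S A) (Nat.iter n t z).
  apply: zeros_split => i Hi. rewrite It Hn ?finv_phi0 // => j Hj.
  rewrite Ez g0_inv_iter app_word_lt ?repeat_length ?nth_repeat //. lia.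
rewrite -(expanding_iter t b L n) in Ey; first lia.
have Bt : bij (Nat.iter n t) by apply: bij_iter; apply: isV_bij (proj1 St).
move/(bij_inj _ _ _ Bt)/(f_equal (fun f => f A)): Ey.
rewrite [RHS]app_word_lt ?repeat_length ?nth_repeat; first lia.
rewrite /z app_word_ge ?repeat_length // Nat.sub_diag app_word_lt /=; [lia|done].
Qed.

(** The log-slope of the conjugate is a homomorphism killing log-slope 0, hence [chi g0] times the
    log-slope. This integer is a unit because [g0] is itself a conjugate, and it is not [-1] because
    a contraction does not become an expansion. *)
Lemma conjV_slope0 s : stab0 s -> lslope (conjV phi s) zeroC = lslope s zeroC.
Proof.
pose chi (s : Cantor -> Cantor) : Zgrp := lslope (conjV phi s) zeroC.
have chiM v w : stab0 v -> stab0 w -> chi (fun x => v (w x)) = gmul Zgrp (chi v) (chi w).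
  move=> Sv Sw. rewrite /chi (conjV_comp _ Sphi) lslope_comp;
    [exact: (proj1 (stab0_conjV _ Sv))|exact: (proj1 (stab0_conjV _ Sw))|].
  rewrite (proj2 (stab0_conjV _ Sw)) /=. lia.
have F v : stab0 v -> chi v = (chi g0 * lslope v zeroC)%Z.
  move=> Sv. rewrite -Zgrp_zpow. apply: (stab_hom_pow _ Zgrp_axioms) => //.
  exact: conjV_slope_kill.
have B := stab_bij _ Sphi.
pose s1 x := phi (g0 (finv phi x)).
have Ss1 : stab0 s1.
  split; first by apply: stab_conj_isV => //; apply: isV_g0.
  by rewrite /s1 finv_phi0 g0_zero phi0.
have E1 : chi s1 = 1%Z.
  rewrite /chi. have -> : conjV phi s1 = g0.
    extensionality x. by rewrite /conjV /s1 !finv_l.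
  exact: lslope_g0.
rewrite F // in E1.
have E2 : chi (finv g0) = (- chi g0)%Z.
  rewrite F; first exact: stab0_finv stab0_g0.
  rewrite -{1}g0_zero lslope_finv; first exact: isV_g0. rewrite lslope_g0. lia.
have N := conjV_g0_inv_not_expanding. rewrite -/(chi (finv g0)) E2 in N.
have E3 : chi g0 = 1%Z.
  case: (Z.eq_mul_1 _ _ E1) => // Em. case: N. by rewrite Em.
move=> Ss. rewrite -/(chi s) F // E3. lia.
Qed.
End FixedZero.

(** Reduction to a map fixing 0: [phi] is composed with some [u] in V sending 0 to [phi^-1 0], and
    conjugation by [u] does not change the slope at the fixed point. *)
Lemma conjV_slope phi s : inStab phi -> stab0 s ->
  lslope (conjV phi s) (finv phi zeroC) = lslope s zeroC.
Proof.
move=> Sphi Ss. have B := stab_bij _ Sphi.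
have [u [Hu Eu]] := isV_transitive zeroC (finv phi zeroC) inQ2_zero
  (proj1 (stab_inQ2_finv _ Sphi _) inQ2_zero).
have Bu := isV_bij _ Hu.
have S' := inStab_comp _ _ Sphi (inStab_isV _ Hu).
rewrite -(conjV_slope0 _ S' _ s Ss); first by rewrite Eu finv_r.
have -> : conjV (fun x => phi (u x)) s = (fun x => finv u (conjV phi s (u x))).
  extensionality x. by rewrite /conjV finv_comp.
have Hc := stab_conjV_isV _ Sphi _ (proj1 Ss).
have Hf := isV_finv _ Hu.
rewrite (lslope_comp (finv u) (fun x => conjV phi s (u x))) //; first exact: isV_comp.
rewrite (lslope_comp (conjV phi s) u) // Eu (conjV_fixed _ Sphi) ?(proj2 Ss) //.
rewrite -Eu lslope_finv //. lia.
Qed.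

(** The element picked by [epsilon] differs from [w] by some [s] fixing 0. The slope of [s] is the
    same before and after conjugation by [phi], so its two contributions cancel. *)
Lemma mu_spec phi w x : inStab phi -> isV w -> inQ2 x -> w zeroC = x ->
  mu phi x = (lslope (conjV phi w) (finv phi zeroC) - lslope w zeroC - nu (finv phi x) + nu x)%Z.
Proof.
move=> Sphi Hw Hx Ew. rewrite /mu.
have [H0 E0] := epsilon_spec (inhabits (fun y : Cantor => y)) (fun v => isV v /\ v zeroC = x)
  (ex_intro _ w (conj Hw Ew)).
set w0 := epsilon _ _ in H0 E0 *. rewrite -/(conjV phi w0).
have B0 := isV_bij _ H0.
pose s y := finv w0 (w y).
have Ss : stab0 s.
  split; first exact: isV_comp (isV_finv _ H0) Hw. rewrite /s Ew -E0. exact: finv_l.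
have -> : w = (fun y => w0 (s y)) by extensionality y; rewrite /s finv_r.
rewrite (conjV_comp _ Sphi w0 s).
rewrite (lslope_comp (conjV phi w0) (conjV phi s)); [exact: stab_conjV_isV|exact: stab_conjV_isV _ (proj1 Ss)|].
rewrite (lslope_comp w0 s) //; first exact: (proj1 Ss).
rewrite (conjV_fixed _ Sphi) ?(proj2 Ss) // (conjV_slope phi s) //. lia.
Qed.

(** The cocycle of [v] transported by [phi] and the cocycle of the conjugate of [v] differ by the
    coboundary of [mu phi]. *)
Lemma mu_cocycle phi v x : inStab phi -> isV v -> inQ2 x ->
  p_v v (finv phi x) =
  (mu phi x - mu phi (finv (fun y => phi (v (finv phi y))) x)
   + p_v (fun y => phi (v (finv phi y))) x)%Z.
Proof.
move=> Sphi Hv Hx. set w := fun y => phi (v (finv phi y)).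
have Hw : isV w by exact: (stab_conj_isV _ Sphi _ Hv).
have Bphi := stab_bij _ Sphi. have Bw := isV_bij _ Hw. have Bv := isV_bij _ Hv.
have Hy : inQ2 (finv w x) by apply: inQ2_finv.
have [u [Hu Eu]] := isV_transitive _ _ inQ2_zero Hy.
have Ew : w (u zeroC) = x by rewrite Eu finv_r.
(* With the representatives [w u] at [x] and [u] at [w^-1 x], the chain rule cancels all slopes of
   [u]. *)
rewrite (mu_spec phi (fun y => w (u y)) x) //; first exact: isV_comp.
rewrite (mu_spec phi u (finv w x)) //.
have Ecw : conjV phi w = v by extensionality y; rewrite /conjV /w !finv_l.
rewrite (conjV_comp _ Sphi w u) Ecw (lslope_comp v) //; first exact: stab_conjV_isV.
rewrite (lslope_comp w u) // Eu /p_v.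
have Ey : finv v (finv phi x) = finv phi (finv w x).
  apply: finv_eq => //. apply: (bij_inj phi) => //. rewrite finv_r //. exact: (finv_r w).
have -> : conjV phi u (finv phi zeroC) = finv phi (finv w x) by rewrite /conjV finv_r // Eu.
rewrite Ey. lia.
Qed.

(** * Commuting families of subgroups permuted by V *)

Definition moves m (a : Cantor -> Cantor) := forall x, prefix m x -> ~ prefix m (a x).
Definition supp_in m (h : Cantor -> Cantor) := forall x, ~ prefix m x -> h x = x.

Lemma moved_cone a x m : contC a -> a x <> x -> prefix m x ->
  exists s, moves (m ++ s) a /\ prefix (m ++ s) x.
Proof.
move=> C ne P.
have [i Hi] : exists i, a x i <> x i.
  apply: NNPP => N. apply: ne. extensionality i. apply: NNPP => N'. apply: N. by exists i.
have [n Hn] := C x (S i). pose k := length m + n + S i.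
have [s Es] : exists s, pre x k = m ++ s.
  apply: (prefix_nested _ _ x) => //; [exact: prefix_pre_self|rewrite pre_length /k; lia].
exists s. rewrite -Es. split; last exact: prefix_pre_self.
move=> y /prefix_pre Py /prefix_pre Qy. rewrite pre_length in Py Qy.
apply: Hi. rewrite -(Hn y).
- by move=> j Hj; apply: pre_eq Py _; rewrite /k; lia.
- lia.
- by apply: pre_eq Qy _; rewrite /k; lia.
Qed.

Lemma moves_sub m s a : moves m a -> moves (m ++ s) a.
Proof. move=> H x /prefix_app_split P /prefix_app_split Q. exact: H P Q. Qed.

Lemma supp_stable m h x : bij h -> supp_in m h -> prefix m x -> prefix m (h x).
Proof.
move=> B S P. apply: NNPP => N. apply: (N). by rewrite (bij_inj h _ _ B (S _ N)).
Qed.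

Lemma supp_finv m h : bij h -> supp_in m h -> supp_in m (finv h).
Proof. move=> B S x N. apply: finv_eq => //. exact: S. Qed.

Lemma supp_swap m s t : disj s t -> supp_in m (swap (m ++ s) (m ++ t)).
Proof. move=> D x N. by apply: swap_out => /prefix_app_split. Qed.

Lemma supp_comp m h k : supp_in m h -> supp_in m k -> supp_in m (fun x => h (k x)).
Proof. move=> H K x N. by rewrite K // H. Qed.

(** On the four quarters of the cone, the 3-cycles of quarters 0, 1, 2 and 1, 2, 3 do not commute;
    being of order 3 rather than 2, they also meet the condition of [family_normalised]. *)
Lemma cone_three_cycles m : exists h k, isV h /\ isV k /\ supp_in m h /\ supp_in m k /\
  (exists t, h (h t) <> t) /\ (exists t, k (k t) <> t) /\ (exists t, h (k t) <> k (h t)).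
Proof.
pose w a b := m ++ [a; b].
have D a b c d : [a; b] <> [c; d] -> disj (w a b) (w c d).
  by move=> ne; apply: disj_sub; apply: disj_same_length.
have D' a b c d : [a; b] <> [c; d] -> disj [a; b] [c; d].
  by move=> ne; apply: disj_same_length.
have N a b c d : [a; b] <> [c; d] -> w a b ^^ zeroC <> w c d ^^ zeroC.
  move=> ne E. apply: (D _ _ _ _ ne (w a b ^^ zeroC)); first exact: prefix_app.
  rewrite E. exact: prefix_app.
pose w0 := w false false. pose w1 := w false true. pose w2 := w true false. pose w3 := w true true.
pose h x := swap w0 w1 (swap w1 w2 x). pose k x := swap w1 w2 (swap w2 w3 x).
have h0 z : h (w0 ^^ z) = w1 ^^ z.
  by rewrite /h swap_loc_out ?swap_l //; apply: D.
have h1 z : h (w1 ^^ z) = w2 ^^ z.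
  by rewrite /h swap_l swap_loc_out //; apply: D.
have k0 z : k (w0 ^^ z) = w0 ^^ z.
  by rewrite /k !swap_loc_out //; apply: D.
have k1 z : k (w1 ^^ z) = w2 ^^ z.
  by rewrite /k swap_loc_out ?swap_l //; apply: D.
have k2 z : k (w2 ^^ z) = w3 ^^ z.
  by rewrite /k swap_l swap_loc_out //; apply: D.
exists h, k. split; [|split; [|split; [|split; [|split; [|split]]]]].
- by apply: isV_comp; apply: isV_swap; apply: D.
- by apply: isV_comp; apply: isV_swap; apply: D.
- by apply: supp_comp; apply: supp_swap; apply: D'.
- by apply: supp_comp; apply: supp_swap; apply: D'.
- exists (w0 ^^ zeroC). rewrite h0 h1. exact: N.
- exists (w1 ^^ zeroC). rewrite k1 k2. exact: N.
- exists (w0 ^^ zeroC). rewrite k0 h0 k1. exact: N.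
Qed.

Section Family.
(** In [aut_base], [A x] is the image in V of [al] on the copy of Gamma at [x]. These subgroups
    commute pairwise ([AC]), are permuted by conjugation ([AJ]), and each element can be conjugated
    into any other of them ([AT]). *)
Variable A : Cantor -> (Cantor -> Cantor) -> Prop.
Hypothesis AV : forall x v, A x v -> isV v.
Hypothesis AM : forall x v w, A x v -> A x w -> A x (fun y => v (w y)).
Hypothesis AI : forall x v, A x v -> A x (finv v).
Hypothesis AC : forall x y v w, inQ2 x -> inQ2 y -> x <> y -> A x v -> A y w ->
  forall t, v (w t) = w (v t).
Hypothesis AJ : forall w x, isV w -> inQ2 x -> exists y, inQ2 y /\
  forall v, A x v -> A y (fun t => w (v (finv w t))).
Hypothesis AT : forall x y v, inQ2 x -> inQ2 y -> A x v ->
  exists w, isV w /\ A y (fun t => w (v (finv w t))).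

(** If [h] carried [A x] into another member, [a] would commute with [h a h^-1]. Since [a] pushes
    the cone [m] off itself and [h] is trivial outside it, comparing both products at [a^-1 (h t)]
    gives [h (h t) = t]. *)
Lemma family_normalised x a m h : inQ2 x -> A x a -> moves m a -> isV h -> supp_in m h ->
  (exists t, h (h t) <> t) -> forall c, A x c -> A x (fun t => h (c (finv h t))).
Proof.
move=> Hx Aa Ma Hh Sh [t ne]. have [y [Hy J]] := AJ h x Hh Hx.
case: (excluded_middle_informative (x = y)) => [E|nxy]; first by subst y.
have Bh := isV_bij _ Hh. have Ba := isV_bij _ (AV _ _ Aa).
have Pt : prefix m t by apply: NNPP => N; apply: ne; rewrite !Sh // Sh.
have Pht := supp_stable _ _ _ Bh Sh Pt.
pose r := finv a (h t). have Er : a r = h t by apply: finv_r.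
have Nr : ~ prefix m r by move=> /Ma; rewrite Er.
case: ne. apply: (bij_inj _ _ _ Ba).
have := AC x y a _ Hx Hy nxy Aa (J _ Aa) r.
by rewrite Er finv_l // (supp_finv _ _ Bh Sh r Nr) Er (Sh _ (Ma _ Pt)).
Qed.

(* If [b] moved a cone moved by [a], then for 3-cycles [h], [k] in that cone the
   element [[h,a],k] = [h,k] would lie in [A x] but not commute with [b]. *)
Lemma family_fixes x y a b m : inQ2 x -> inQ2 y -> x <> y -> A x a -> A y b -> moves m a ->
  forall t, prefix m t -> b t = t.
Proof.
move=> Hx Hy nxy Aa Ab Ma t Pt. apply: NNPP => ne.
have [s [Mb _]] := moved_cone b t m (isV_cont _ (AV _ _ Ab)) ne Pt.
have {}Ma := moves_sub _ s _ Ma. move: (m ++ s) Mb Ma => {Pt s} n Mb {}Ma.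
have [h [k [Hh [Hk [Sh [Sk [Ih [Ik [u Nu]]]]]]]]] := cone_three_cycles n.
have Bh := isV_bij _ Hh. have Bk := isV_bij _ Hk. have Ba := isV_bij _ (AV _ _ Aa).
pose c t := h (a (finv h (finv a t))).
have Ac : A x c.
  apply: (AM x (fun t => h (a (finv h t))) (finv a)); last exact: AI.
  exact: (family_normalised x a n h Hx Aa Ma Hh Sh Ih a Aa).
have Bc := isV_bij _ (AV _ _ Ac).
pose d t := c (k (finv c (finv k t))).
have Ad : A x d.
  apply: (AM x c (fun t => k (finv c (finv k t)))) => //.
  exact: (family_normalised x a n k Hx Aa Ma Hk Sk Ik _ (AI _ _ Ac)).
(* Here [finv a] takes [r] off the cone, where [finv h] is trivial, and [a] brings it back, so only
   the outer [h] acts. *)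
have Ec r : prefix n r -> c r = h r.
  move=> Pr. rewrite /c (supp_finv _ _ Bh Sh) ?finv_r // => P.
  by apply: (Ma _ P); rewrite finv_r.
have Pu : prefix n u by apply: NNPP => N; apply: Nu; rewrite !Sh ?Sk ?Sh.
have Phu := supp_stable _ _ _ Bh Sh Pu. have Pku := supp_stable _ _ _ Bk Sk Pu.
have Pkhu := supp_stable _ _ _ Bk Sk Phu.
have Ed : d (k (h u)) = h (k u).
  by rewrite /d finv_l // -Ec // finv_l // Ec.
have Nb := Mb _ Pkhu.
have Fd : d (b (k (h u))) = b (k (h u)).
  rewrite /d (supp_finv _ _ Bk Sk) // Sk ?finv_r // => P.
  apply: Nb. rewrite -(finv_r c (b _) Bc) Ec //. exact: supp_stable.
apply: Nu. rewrite -Ed. apply: (bij_inj b _ _ (isV_bij _ (AV _ _ Ab))).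
by rewrite -(AC x y d b Hx Hy nxy Ad Ab).
Qed.

(** Only half of [m] is swapped with [n], so the conjugate of [v] by [s] moves points of [n] as well
    as points of [m]. In [A x] this conflicts with [b], which lies in another member and moves [n];
    in any other member it conflicts with [v], which moves [m]. *)
Lemma family_trivial x v : inQ2 x -> A x v -> v = (fun t => t).
Proof.
move=> Hx Av. extensionality t. apply: NNPP => ne.
have [y [Hy Ny]] := fresh_point [x]. have nxy : x <> y by move=> E; apply: Ny; left.
have nyx := not_eq_sym nxy.
have [w [Hw Ab]] := AT x y v Hx Hy Av. set b := (fun _ => _) in Ab.
have Bw := isV_bij _ Hw. have Bv := isV_bij _ (AV _ _ Av).
have neb : b (w t) <> w t by rewrite /b finv_l // => /(bij_inj _ _ _ Bw).
have [m [Mv _]] := moved_cone v t [] (isV_cont _ (AV _ _ Av)) ne ltac:(move=> i /=; lia).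
have [n [Mb _]] := moved_cone b (w t) [] (isV_cont _ (AV _ _ Ab)) neb ltac:(move=> i /=; lia).
rewrite /= in Mv Mb.
have Fb := family_fixes x y v b m Hx Hy nxy Av Ab Mv.
have Fv := family_fixes y x b v n Hy Hx nyx Ab Av Mb.
have D : disj m n.
  move=> z Pm Pn. apply: (Mb z Pn). by rewrite Fb.
have Out z : prefix m z -> ~ prefix n (v z).
  move=> Pz Q. apply: (D z Pz). by rewrite -{1}(bij_inj v (v z) z Bv (Fv _ Q)).
have Dn : disj (m ++ [true]) n by move=> z /prefix_app_split; apply: D.
pose s := swap (m ++ [true]) n. have Hs : isV s by apply: isV_swap.
have Es : finv s = s by apply: swap_finv.
have Sout z : ~ prefix m z -> ~ prefix n z -> s z = z.
  by move=> Nm Nn; apply: swap_out => // /prefix_app_split.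
have [r [Hr J]] := AJ s x Hs Hx. have {J}Ar := J _ Av. rewrite Es in Ar.
have P0 c z : prefix m ((m ++ [c]) ^^ z) by apply: prefix_app_split (prefix_app _ _).
case: (excluded_middle_informative (x = r)) => [Er|nxr].
  subst r. have := family_fixes y x b _ n Hy Hx nyx Ab Ar Mb (n ^^ zeroC) (prefix_app _ _).
  rewrite {2}/s swap_r // Sout; [exact: Mv|exact: Out|].
  move=> E. apply: (Out ((m ++ [true]) ^^ zeroC)) => //. rewrite E. exact: prefix_app.
have := family_fixes x r v _ m Hx Hr nxr Av Ar Mv _ (P0 false zeroC).
rewrite {2}/s swap_loc_out;
  [exact: disj_sym (disj_01 m)|by apply: disj_sym => z /prefix_app_split; apply: D|].
rewrite Sout; [exact: Mv|exact: Out|].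
move=> E. apply: (Mv ((m ++ [false]) ^^ zeroC)) => //. by rewrite E.
Qed.

End Family.

(** * Equivariant families of finite sets of dyadic points *)

Section Supports.
(** In the application [I] is the set of nontrivial elements of Gamma and [S x i] is the support of
    [al (Dl x i)]; keeping the index explicit yields one common point for all [i]. *)
Variables (I : Type) (S : Cantor -> I -> Cantor -> Prop) (psi : (Cantor -> Cantor) -> Cantor -> Cantor).
Hypothesis Sfin : forall x i, inQ2 x -> exists l, forall y, S x i y -> In y l.
Hypothesis SQ2 : forall x i y, inQ2 x -> S x i y -> inQ2 y.
Hypothesis Sne : forall x i, inQ2 x -> exists y, S x i y.
Hypothesis psiV : forall v, isV v -> isV (psi v).
Hypothesis psi_surj : forall w, isV w -> exists v, isV v /\ psi v = w.
Hypothesis SE : forall v x i y, isV v -> inQ2 x -> (S (v x) i (psi v y) <-> S x i y).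

(** For one pair [zeroC], [w zeroC] the supports are disjoint, because [psi w] can be chosen to push
    a finite set off itself; 2-transitivity carries every other pair to this one. *)
Lemma supports_disjoint x x' i y : inQ2 x -> inQ2 x' -> x <> x' -> S x i y -> S x' i y -> False.
Proof.
move=> Hx Hx' ne Sy Sy'.
have [l [HQ Hl]] : exists l, (forall q, In q l -> inQ2 q) /\ forall q, S zeroC i q -> In q l.
  have [l Hl] := Sfin zeroC i inQ2_zero.
  exists (filter (fun q => if excluded_middle_informative (inQ2 q) then true else false) l).
  split=> q.
    by move/filter_In => [_]; case: excluded_middle_informative.
  move=> Sq. apply/filter_In. split; first exact: Hl.
  case: excluded_middle_informative => // -[]. exact: SQ2 inQ2_zero Sq.
have [v [Hv Nv]] := isV_push_off l l HQ. have [w [Hw Ew]] := psi_surj v Hv.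
have nz : zeroC <> w zeroC.
  move=> E. have [q Sq] := Sne zeroC i inQ2_zero. apply: (Nv q); first exact: Hl.
  apply: Hl. rewrite {1}E -Ew. exact: (proj2 (SE _ _ _ _ Hw inQ2_zero) Sq).
have Hz : inQ2 (w zeroC) := proj1 (inQ2_isV _ _ Hw) inQ2_zero.
have [u [Hu [E0 Ez]]] := isV_two_transitive _ _ _ _ Hx Hx' inQ2_zero Hz ne nz.
have S0 : S zeroC i (psi u y) by rewrite -E0; exact: (proj2 (SE _ _ _ _ Hu Hx) Sy).
have Sz : S (w zeroC) i (psi u y) by rewrite -Ez; exact: (proj2 (SE _ _ _ _ Hu Hx') Sy').
have E : psi u y = psi w (finv v (psi u y)) by rewrite Ew finv_r //; apply: isV_bij.
rewrite E in Sz. apply: (Nv _ (Hl _ (proj1 (SE _ _ _ _ Hw inQ2_zero) Sz))).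
rewrite finv_r; [exact: isV_bij|exact: Hl].
Qed.

(** Otherwise some [psi w] fixes [y] and moves [y'] outside [S x j]. Fixing [y] forces [w x = x] by
    disjointness, and then [S x j] is stable under [psi w], a contradiction. *)
Lemma supports_singleton x i j y y' : inQ2 x -> S x i y -> S x j y' -> y = y'.
Proof.
move=> Hx Sy Sy'. apply: NNPP => ne. have [l Hl] := Sfin x j Hx.
have [r [Hr Nr]] := fresh_point (y :: l).
have [s [Hs [Es Fs]]] := move_point [y] y' r (SQ2 _ _ _ Hx Sy') Hr.
have Ey : s y = y by apply: Fs => //; [left|move=> E; apply: Nr; left].
have [w [Hw Ew]] := psi_surj s Hs.
have Ewx : x = w x.
  apply: NNPP => N. apply: (supports_disjoint x (w x) i y) => //.
    exact: (proj1 (inQ2_isV _ _ Hw) Hx).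
  rewrite -Ey -Ew. exact: (proj2 (SE _ _ _ _ Hw Hx) Sy).
apply: Nr. right. apply: Hl. rewrite Ewx -Es -Ew. exact: (proj2 (SE _ _ _ _ Hw Hx) Sy').
Qed.

End Supports.

(** * Extending bijections of the dyadic points to homeomorphisms *)

Definition unif_Q2 (f : Cantor -> Cantor) := forall n, exists N, forall x y, inQ2 x -> inQ2 y ->
  (forall i, i < N -> x i = y i) -> f x n = f y n.

(** Digit [n] controls a change of the next digit: an involution in V whose fixed-point set is the
    clopen set where digit [n] is 0. *)
Definition flip n : Cantor -> Cantor := fun x i => if Nat.eqb i (S n) then xorb (x i) (x n) else x i.

Lemma flip_invol n x : flip n (flip n x) = x.
Proof.
extensionality i. rewrite /flip. case: (Nat.eqb_spec i (S n)) => [->|//].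
rewrite (proj2 (Nat.eqb_neq n (S n))); [lia|]. by case: (x (S n)); case: (x n).
Qed.

Lemma isV_flip n : isV (flip n).
Proof.
apply: isV_intro; first by exists (flip n); split; apply: flip_invol.
move=> x. exists (pre x (n + 2)), (pre (flip n x) (n + 2)). split; first exact: prefix_pre_self.
move=> z. extensionality i.
have Ep j : j < n + 2 -> (pre x (n + 2) ^^ z) j = x j.
  by move=> Hj; rewrite app_word_lt ?pre_length // nth_pre.
case: (Nat.lt_ge_cases i (n + 2)) => Hi.
  rewrite [RHS]app_word_lt ?pre_length // nth_pre // /flip !Ep //. lia.
rewrite [RHS]app_word_ge pre_length // /flip.
rewrite (proj2 (Nat.eqb_neq i (S n))); [lia|]. by rewrite app_word_ge pre_length.
Qed.

Lemma flip_fixed n x : flip n x = x <-> x n = false.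
Proof.
split=> [/(f_equal (fun f => f (S n)))|E].
  rewrite /flip Nat.eqb_refl. by case: (x (S n)); case: (x n).
extensionality i. rewrite /flip E. case: Nat.eqb_spec => // _. by case: (x i).
Qed.

(* Elements of finite order have slope 1 at fixed points, so their fixed-point sets are clopen. *)
Lemma invol_fix_clopen t : isV t -> (forall x, t (t x) = x) -> exists N, forall x y,
  (forall i, i < N -> x i = y i) -> t x = x -> t y = y.
Proof.
move=> H I. have [N U] := locally_affine_unif _ (isV_locally_affine _ H).
exists N => x y Hxy E. have [m' L] := U (pre x N) (pre_length _ _).
have P := prefix_pre_self x N.
have Sl : lslope t x = 0%Z.
  have := lslope_comp t t x H H. rewrite E. have -> : (fun y => t (t y)) = (fun y => y).
    by extensionality z.
  rewrite lslope_id. lia.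
rewrite (lslope_loc t _ _ x H P L) pre_length in Sl.
have Em : pre x N = m'.
  have := E. rewrite -{1}(app_pre_drop x N) L -{2}(app_pre_drop x N).
  move/app_word_eq_len => [|<- //]. rewrite pre_length. lia.
by rewrite -(app_pre_drop y N) -(pre_ext x y N Hxy) L -Em.
Qed.

(** Digit [n] of [f x] vanishes when [flip n] fixes [f x], that is, when the involution [t]
    corresponding to [flip n] fixes [x]; a prefix of bounded length decides the latter. *)
Lemma equivariant_unif f : (forall x, inQ2 x -> inQ2 (f x)) ->
  (forall x y, inQ2 x -> inQ2 y -> f x = f y -> x = y) ->
  (forall s, isV s -> exists t, isV t /\ forall q, inQ2 q -> f (t q) = s (f q)) -> unif_Q2 f.
Proof.
move=> Q Inj Eq n. have [t [Ht Et]] := Eq _ (isV_flip n).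
have I x : t (t x) = x.
  apply: (f_equal (fun g => g x)
    (cont_dense (fun x => t (t x)) (fun x => x) _ contC_id _)).
    by apply: contC_comp; apply: isV_cont.
  move=> q Hq. have Hq' := proj1 (inQ2_isV _ _ Ht) Hq.
  apply: Inj => //; first exact: (proj1 (inQ2_isV _ _ Ht) Hq').
  by rewrite !Et // flip_invol.
have [N HN] := invol_fix_clopen t Ht I.
exists N => x y Hx Hy E.
have F z : inQ2 z -> f z n = false <-> t z = z.
  move=> Hz. rewrite -flip_fixed -Et //. split=> [|-> //]. apply: Inj => //. exact: (proj1 (inQ2_isV _ _ Ht) Hz).
have E' i : i < N -> y i = x i by move=> Hi; rewrite E.
have W : f x n = false <-> f y n = false.
  rewrite !F //. split; exact: HN.
case Ex: (f x n); case Ey: (f y n) => //; [by rewrite (proj2 W Ey) in Ex|by rewrite (proj1 W Ex) in Ey].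
Qed.

Lemma contC_digitwise f : (forall x n, exists m, forall y, (forall i, i < m -> y i = x i) -> f y n = f x n) ->
  contC f.
Proof.
move=> H x. elim=> [|n [m Hm]]; first by exists 0 => y _ i; lia.
have [k Hk] := H x n. exists (m + k) => y Hy i Hi.
case: (Nat.eq_dec i n) => [->|ne]; first by apply: Hk => j Hj; apply: Hy; lia.
apply: Hm; [|lia]. move=> j Hj; apply: Hy; lia.
Qed.

Lemma unif_extend f : unif_Q2 f -> exists F, contC F /\ forall x, inQ2 x -> F x = f x.
Proof.
move=> U. pose N n := epsilon (inhabits 0) (fun N => forall x y, inQ2 x -> inQ2 y ->
  (forall i, i < N -> x i = y i) -> f x n = f y n).
have HN n : forall x y, inQ2 x -> inQ2 y -> (forall i, i < N n -> x i = y i) -> f x n = f y n.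
  exact: (epsilon_spec _ _ (U n)).
exists (fun x n => f (pre x (N n) ^^ zeroC) n).
have Q x k : inQ2 (pre x k ^^ zeroC) by apply/inQ2_app; apply: inQ2_zero.
split.
  apply: contC_digitwise => x n. exists (N n) => y Hy. by rewrite (pre_ext y x).
move=> x Hx. extensionality n. apply: HN => // i Hi.
by rewrite app_word_lt ?pre_length // nth_pre.
Qed.

(** * The wreath product and its elementary automorphisms *)

Section WreathProduct.
Variables (Gm : Grp) (HGm : group_axioms Gm).
Local Notation T := (car Gm).
Local Notation e := (gone Gm).
Local Notation inv := (ginv Gm).
Local Infix "*" := (gmul Gm).
Local Notation G := (GbarT Gm).
Local Notation inG := (inG Gm).
Local Notation Gmul := (Gmul Gm).
Local Notation Ginv := (Ginv Gm).
Local Notation isAutG := (isAutG Gm).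
Local Notation mulA := (mulA Gm HGm).
Local Notation mul1g := (mul1g Gm HGm).
Local Notation mulg1 := (mulg1 Gm HGm).
Local Notation mulVg := (mulVg Gm HGm).
Local Notation mulgV := (mulgV Gm HGm).
Local Notation mulKg := (mulKg Gm HGm).
Local Notation mulKVg := (mulKVg Gm HGm).
Local Notation invM := (invM Gm HGm).
Local Notation invK := (invK Gm HGm).
Local Notation inv1 := (inv1 Gm HGm).

Ltac gsimp := rewrite ?invM ?invK ?inv1 -?mulA
  ?(mulKg, mulKVg, mulVg, mulgV, mul1g, mulg1).

Definition oneG : G := (fun _ => e, fun x => x).

Lemma Geq (g h : G) : (forall x, fst g x = fst h x) -> (forall x, snd g x = snd h x) -> g = h.
Proof.
case: g => [a v]; case: h => [b w] /= E1 E2.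
have -> : a = b by extensionality x. by have -> : v = w by extensionality x.
Qed.

Lemma inKbar_finv (a : Cantor -> T) v x : inKbar Gm a -> isV v -> ~ inQ2 x -> a (finv v x) = e.
Proof. move=> K H N. apply: K. by rewrite -(inQ2_isV _ x (isV_finv _ H)). Qed.

Lemma inG_one : inG oneG.
Proof. split; [split=> //; by exists nil|exact: isV_id]. Qed.

Lemma inG_mul g h : inG g -> inG h -> inG (Gmul g h).
Proof.
case: g => [a v]; case: h => [b w] [[/= Ka [la Ha]] Hv] [[/= Kb [lb Hb]] Hw].
split; last exact: isV_comp. split=> /= [x N|].
  by rewrite Ka // (inKbar_finv b v) // mul1g.
exists (la ++ map v lb) => x ne. apply/in_app_iff.
case: (excluded_middle_informative (a x = e)) => [E|/Ha]; last by left.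
right. apply/in_map_iff. exists (finv v x). split; first by apply: finv_r; apply: isV_bij.
apply: Hb => E'. apply: ne. by rewrite E E' mul1g.
Qed.

Lemma inG_inv g : inG g -> inG (Ginv g).
Proof.
case: g => [a v] [[/= Ka [la Ha]] Hv]. split; last exact: isV_finv. split=> /= [x N|].
  rewrite Ka ?inv1 //. by rewrite -(inQ2_isV _ x Hv).
exists (map (finv v) la) => x ne. apply/in_map_iff. exists (v x).
split; first by apply: finv_l; apply: isV_bij.
apply: Ha => E. apply: ne. by rewrite E inv1.
Qed.

Lemma Gmul_assoc g h k : inG g -> inG h -> Gmul g (Gmul h k) = Gmul (Gmul g h) k.
Proof.
move=> [_ Hg] [_ Hh]. apply: Geq => x //=.
rewrite (finv_comp (snd g) (snd h)); [exact: isV_bij|exact: isV_bij|exact: mulA].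
Qed.

Lemma Gmul_1g g : Gmul oneG g = g.
Proof. apply: Geq => x //=. by rewrite finv_id mul1g. Qed.

Lemma Gmul_g1 g : Gmul g oneG = g.
Proof. apply: Geq => x //=. by rewrite mulg1. Qed.

Lemma Gmul_Vg g : inG g -> Gmul (Ginv g) g = oneG.
Proof.
move=> [_ H]. have B := isV_bij _ H. apply: Geq => x /=; last by rewrite finv_l.
by rewrite finv_finv // mulVg.
Qed.

Lemma Gmul_cancel g h k : inG g -> inG h -> inG k -> Gmul g h = Gmul g k -> h = k.
Proof.
move=> Hg Hh Hk E. have Hi := inG_inv _ Hg.
by rewrite -(Gmul_1g h) -(Gmul_Vg g) // -Gmul_assoc // E Gmul_assoc // Gmul_Vg // Gmul_1g.
Qed.

Lemma isAutG_comp al be : isAutG al -> isAutG be -> isAutG (fun g => al (be g)).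
Proof.
move=> [A1 [A2 [A3 A4]]] [B1 [B2 [B3 B4]]]. split; [|split; [|split]].
- move=> g Hg. exact: A1 (B1 _ Hg).
- move=> g h Hg Hh. by rewrite B2 // A2 //; apply: B1.
- move=> g h Hg Hh /A3 E. apply: B3 => //. by apply: E; apply: B1.
- move=> h Hh. have [k [Hk <-]] := A4 h Hh. have [g [Hg <-]] := B4 k Hk. by exists g.
Qed.

Lemma aut_one al : isAutG al -> al oneG = oneG.
Proof.
move=> [A1 [A2 _]]. have H := A1 _ inG_one.
apply: (Gmul_cancel (al oneG)) => //; first exact: inG_one.
by rewrite Gmul_g1 -A2 ?Gmul_1g //; apply: inG_one.
Qed.

Lemma rq_in (h : Cantor -> T) x : inQ2 x -> restrictQ2 Gm h x = h x.
Proof. rewrite /restrictQ2. by case: excluded_middle_informative. Qed.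

Lemma rq_out (h : Cantor -> T) x : ~ inQ2 x -> restrictQ2 Gm h x = e.
Proof. rewrite /restrictQ2. by case: excluded_middle_informative. Qed.

Lemma notQ2_finv v x : isV v -> ~ inQ2 x -> ~ inQ2 (finv v x).
Proof. move=> H N. by rewrite -(inQ2_isV _ x (isV_finv _ H)). Qed.

Ltac q2case x := case: (excluded_middle_informative (inQ2 x)).

Lemma ad_fst f g x : isV (snd g) ->
  fst (ad Gm f g) x = f x * (fst g x * inv (f (finv (snd g) x))).
Proof. case: g => [a v] /= H. by rewrite !finv_id -mulA. Qed.

Lemma ad_snd f g : snd (ad Gm f g) = snd g.
Proof. case: g => [a v] /=. by rewrite finv_id. Qed.

Lemma Ez_fst z g x :
  fst (Ez Gm z g) x = fst g x * restrictQ2 Gm (fun x => zpow Gm z (p_v (snd g) x)) x.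
Proof. done. Qed.

Lemma Ez_snd z g : snd (Ez Gm z g) = snd g.
Proof. done. Qed.

Lemma Aphib_fst phi b g x : fst (Aphib Gm phi b g) x = b (fst g (finv phi x)).
Proof. done. Qed.

Lemma Aphib_snd phi b g : snd (Aphib Gm phi b g) = (fun x => phi (snd g (finv phi x))).
Proof. done. Qed.

Lemma ad_comp f f' g : isV (snd g) -> ad Gm f (ad Gm f' g) = ad Gm (pmul Gm f f') g.
Proof.
move=> H. apply: Geq => x; last by rewrite !ad_snd.
by rewrite !ad_fst ?ad_snd // /pmul; gsimp.
Qed.

Lemma Ez_comp z z' g : central Gm z -> Ez Gm z (Ez Gm z' g) = Ez Gm (z * z') g.
Proof.
move=> C. apply: Geq => //= x. rewrite /pmul. q2case x => [Hx|N]; last by rewrite !rq_out // !mulg1.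
rewrite !rq_in // zpow_mul // -mulA. by rewrite (central_zpow _ HGm _ _ C).
Qed.

Lemma Ez_ad z f g : central Gm z -> isV (snd g) -> Ez Gm z (ad Gm f g) = ad Gm f (Ez Gm z g).
Proof.
move=> C H. apply: Geq => [x|x]; last by rewrite ad_snd !Ez_snd ad_snd.
rewrite [RHS]ad_fst // !Ez_fst Ez_snd ad_fst // ad_snd.
q2case x => [Hx|N]; last by rewrite !rq_out // !mulg1.
by rewrite !rq_in // -!mulA (central_zpow _ HGm _ _ C).
Qed.

Lemma Aphib_comp phi psi b c g : bij phi -> bij psi ->
  Aphib Gm phi b (Aphib Gm psi c g) = Aphib Gm (fun x => phi (psi x)) (fun h => b (c h)) g.
Proof. move=> B1 B2. apply: Geq => x /=; by rewrite (finv_comp phi psi). Qed.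

Lemma conj_finv phi v x : bij phi -> bij v ->
  finv phi (finv (fun y => phi (v (finv phi y))) x) = finv v (finv phi x).
Proof.
move=> B Bv. have Bi := finv_bij _ B.
rewrite (finv_comp phi (fun y => v (finv phi y))) //; first exact: bij_comp.
by rewrite (finv_comp v (finv phi)) // finv_finv // finv_l.
Qed.

Lemma Aphib_ad phi b f g : bij phi -> isAutGamma Gm b -> isV (snd g) ->
  isV (fun y => phi (snd g (finv phi y))) ->
  Aphib Gm phi b (ad Gm f g) = ad Gm (fun x => b (f (finv phi x))) (Aphib Gm phi b g).
Proof.
move=> B A H H'. apply: Geq => x; last by rewrite ad_snd !Aphib_snd ad_snd.
rewrite [RHS]ad_fst // !Aphib_fst Aphib_snd ad_fst //.
by rewrite !(proj1 A) (autV _ HGm) // conj_finv //; apply: isV_bij.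
Qed.

Definition mu_twist phi z := restrictQ2 Gm (fun x => zpow Gm z (mu phi x)).

(** Moving [A] past [E_z] costs a conjugation by the twist; this is the origin of the factor with
    [mu] in [sigma_f]. *)
Lemma Aphib_Ez phi b z g : inStab phi -> isAutGamma Gm b -> central Gm z -> isV (snd g) ->
  Aphib Gm phi b (Ez Gm z g) = Ez Gm (b z) (ad Gm (mu_twist phi (b z)) (Aphib Gm phi b g)).
Proof.
move=> S A C H. have H' := stab_conj_isV _ S _ H. have Cb := aut_central _ _ _ A C.
apply: Geq => [x|x]; last by rewrite Ez_snd ad_snd.
rewrite Aphib_fst !Ez_fst ad_fst // ad_snd Aphib_fst Aphib_snd (proj1 A).
set w := fun y => phi (snd g (finv phi y)).
q2case x => [Hx|N]; last first.
  have N' : ~ inQ2 (finv phi x) by rewrite -(stab_inQ2_finv _ S).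
  have N2 := notQ2_finv _ _ H' N.
  by rewrite /mu_twist !rq_out // (aut1 _ HGm) //; gsimp.
have Hx' := proj1 (stab_inQ2_finv _ S _) Hx. have H2 := inQ2_finv _ _ H' Hx.
rewrite /mu_twist !rq_in // (aut_zpow _ HGm) // (mu_cocycle phi (snd g) x S H Hx) -/w.
move: (mu phi x) (mu phi (finv w x)) (p_v w x) => k1 k2 k3.
rewrite -Z.add_opp_r !(zpow_add _ HGm) (zpow_opp _ HGm) -!mulA.
by rewrite [LHS]mulA -(central_zpow _ HGm (b z) k1 Cb) -!mulA.
Qed.

Lemma Ez_inG z g : inG g -> inG (Ez Gm z g).
Proof.
case: g => [a v] [[/= Ka [la Ha]] Hv]. split=> //. split=> /= [x N|].
  by rewrite /pmul Ka // rq_out // mul1g.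
have [lp Hp] := p_v_finite v Hv. exists (la ++ lp) => x ne. apply/in_app_iff.
case: (excluded_middle_informative (a x = e)) => [E|/Ha]; last by left.
move: ne. rewrite /pmul E mul1g. q2case x => [Hx|N]; last by rewrite rq_out.
rewrite rq_in // => ne. right. apply: Hp => // E'. apply: ne. by rewrite E'.
Qed.

Lemma Ez_one g : Ez Gm e g = g.
Proof.
apply: Geq => //= x. rewrite /pmul. q2case x => [Hx|N]; last by rewrite rq_out // mulg1.
by rewrite rq_in // zpow_e // mulg1.
Qed.

Lemma Ez_aut z : central Gm z -> isAutG (Ez Gm z).
Proof.
move=> C. have C' := centralV _ HGm _ C. split; [|split; [|split]].
- exact: Ez_inG.
- case=> [a v] [b w] [_ /= Hv] [_ /= Hw]. apply: Geq => //= x. rewrite /pmul.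
  q2case x => [Hx|N].
    have Hx' := inQ2_finv _ _ Hv Hx. rewrite !rq_in // p_v_comp // zpow_add // -!mulA. f_equal.
    by rewrite !mulA (central_zpow _ HGm _ _ C).
  have N' := notQ2_finv _ _ Hv N. by rewrite !rq_out // !mulg1.
- move=> g h _ _ E. rewrite -(Ez_one g) -(Ez_one h) -(mulVg z) -!Ez_comp //. by rewrite E.
- move=> h Hh. exists (Ez Gm (inv z) h). split; first exact: Ez_inG.
  by rewrite Ez_comp // mulgV Ez_one.
Qed.

Lemma ad_aut f : inNKG Gm f -> isAutG (ad Gm f).
Proof.
move=> [K [I S]]. split=> //. split; [|split=> //].
- move=> g h [_ Hg] [_ Hh]. have Hgh := isV_comp _ _ Hg Hh. apply: Geq => x; last by rewrite /= !finv_id.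
  rewrite ad_fst // [RHS]/= -!/(ad _ _ _). rewrite !finv_id.
  rewrite (finv_comp (snd g) (snd h)); [exact: isV_bij|exact: isV_bij|]. by gsimp.
- move=> g h [_ Hg] [_ Hh] E. have Es : snd g = snd h by rewrite -(ad_snd f g) E ad_snd.
  apply: Geq => x; last by rewrite Es.
  move: (f_equal (fun k => fst k x) E). rewrite !ad_fst // Es => /(mulgI _ HGm)/(mulIg _ HGm). done.
Qed.

Lemma Aphib_inG phi b g : inStab phi -> isAutGamma Gm b -> inG g -> inG (Aphib Gm phi b g).
Proof.
move=> S A. case: g => [a v] [[/= Ka [la Ha]] Hv]. split; last exact: stab_conj_isV.
split=> /= [x N|].
  by rewrite Ka ?(aut1 _ HGm) // -(stab_inQ2_finv _ S).
exists (map phi la) => x ne. apply/in_map_iff. exists (finv phi x).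
split; first by apply: finv_r; apply: stab_bij.
apply: Ha => E. apply: ne. by rewrite E (aut1 _ HGm).
Qed.

Lemma Aphib_aut phi b : inStab phi -> isAutGamma Gm b -> isAutG (Aphib Gm phi b).
Proof.
move=> S A. have B := stab_bij _ S. split; [|split; [|split]].
- move=> g. exact: Aphib_inG.
- case=> [a v] [c w] [_ /= Hv] [_ /= Hw]. apply: Geq => x /=; last by rewrite finv_l.
  by rewrite (proj1 A) conj_finv //; apply: isV_bij.
- case=> [a v] [c w] [_ /= Hv] [_ /= Hw] E. apply: Geq => x /=.
    have := f_equal (fun k => fst k (phi x)) E. rewrite /= finv_l //. exact: (proj1 (proj2 A)).
  have := f_equal (fun k => snd k (phi x)) E. rewrite /= finv_l //. exact: bij_inj.
- case=> [c w] [[/= Kc [lc Hc]] Hw].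
  (* A chosen inverse of [b]; it must send [e] to [e] for the preimage built from it to have finite
     support. *)
  pose bi y := epsilon (inhabits e) (fun x => b x = y).
  have Hbi y : b (bi y) = y by apply: (epsilon_spec (inhabits e) (fun x => b x = y)); case: A => _ [].
  have bi1 : bi e = e by apply: (proj1 (proj2 A)); rewrite Hbi (aut1 _ HGm).
  exists (fun x => bi (c (phi x)), conjV phi w). split.
    split; last exact: stab_conjV_isV. split=> /= [x N|].
      by rewrite Kc // -(stab_inQ2 _ S).
    exists (map (finv phi) lc) => x ne. apply/in_map_iff. exists (phi x).
    split; first exact: finv_l. apply: Hc => E. apply: ne. by rewrite E.
  apply: Geq => x /=; by rewrite /conjV ?Hbi !finv_r.
Qed.

(** * The map Xi and its multiplicativity *)

Lemma Xi_aut q : inQ Gm q -> isAutG (Xi Gm q).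
Proof.
case: q => [[[z f] phi] b] [Cz [Nf [S A]]].
apply: (isAutG_comp (Ez Gm z) (fun g => ad Gm f (Aphib Gm phi b g))); first exact: Ez_aut.
apply: isAutG_comp; [exact: ad_aut|exact: Aphib_aut].
Qed.

Lemma Xi_well_defined q q' : inQ Gm q -> inQ Gm q' -> Qeq Gm q q' ->
  forall g, inG g -> Xi Gm q g = Xi Gm q' g.
Proof.
case: q => [[[z f] phi] b]; case: q' => [[[z' f'] phi'] b'].
move=> [Cz [Nf [S A]]] _ [<- [[c [Cc ->]] [E1 E2]]] g Hg.
have <- : phi = phi' by extensionality x. have <- : b = b' by extensionality x.
rewrite /Xi. f_equal. have := Aphib_inG _ _ _ S A Hg. move: (Aphib _ _ _ _) => {Hg}g [_ Hg].
apply: Geq => x; last by rewrite !ad_snd.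
rewrite !ad_fst // /pmul. q2case x => [Hx|N].
  have Hx' := inQ2_finv _ _ Hg Hx. rewrite /constQ !rq_in //; gsimp.
  by rewrite (mulA (fst g x) (inv c)) -(centralV _ HGm _ Cc) -!mulA mulKVg.
have N' := notQ2_finv _ _ Hg N. by rewrite /constQ !rq_out // !mulg1.
Qed.

(** The commutation rules sort the composite into the order E, ad, A. What remains is to move the
    central twist to the other side of the transported [f2]. *)
Lemma Xi_mul q1 q2 g : inQ Gm q1 -> inQ Gm q2 -> inG g ->
  Xi Gm (Qmul Gm q1 q2) g = Xi Gm q1 (Xi Gm q2 g).
Proof.
case: q1 => [[[z1 f1] phi1] b1]; case: q2 => [[[z2 f2] phi2] b2].
move=> [Cz1 [Nf1 [S1 A1]]] [Cz2 [Nf2 [S2 A2]]] Hg.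
have B1 := stab_bij _ S1. have B2 := stab_bij _ S2.
have Cb := aut_central _ _ _ A1 Cz2.
rewrite /Qmul /Xi. have [_ H2] := Aphib_inG _ _ _ S2 A2 Hg.
rewrite -Aphib_comp //. move: (Aphib _ phi2 b2 g) H2 => k Hk.
have Hk1 := stab_conj_isV _ S1 _ Hk.
rewrite Aphib_Ez ?ad_snd // -Ez_ad ?ad_snd ?Aphib_snd ?ad_snd // Ez_comp //.
rewrite Aphib_ad // !ad_comp ?ad_snd //. f_equal. f_equal.
extensionality x. rewrite /pmul /sigma_f /pmul -/(mu_twist phi1 (b1 z2)) -mulA. f_equal.
rewrite /mu_twist. q2case x => [Hx|N]; last by rewrite !rq_out // mul1g mulg1.
by rewrite !rq_in // (central_zpow _ HGm _ _ Cb).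
Qed.

(** * Generators of G: point masses and elements of V *)

Definition delta x (g : T) : Cantor -> T :=
  fun y => if excluded_middle_informative (y = x) then g else e.
Definition Dl x g : G := (delta x g, fun y => y).
Definition Vl (v : Cantor -> Cantor) : G := (fun _ => e, v).

Lemma delta_eq x g : delta x g x = g.
Proof. rewrite /delta. by case: excluded_middle_informative. Qed.

Lemma delta_ne x y g : y <> x -> delta x g y = e.
Proof. rewrite /delta. by case: excluded_middle_informative. Qed.

Lemma inG_Dl x g : inQ2 x -> inG (Dl x g).
Proof.
move=> Hx. split; last exact: isV_id. split.
  move=> y N. apply: delta_ne => E. by rewrite E in N.
exists [x] => y ne. left. apply: NNPP => N. apply: ne. apply: delta_ne => E. by apply: N.
Qed.

Lemma inG_Vl v : isV v -> inG (Vl v).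
Proof. move=> H. split=> //. split=> //. by exists nil. Qed.

Lemma Dl_mul x g h : Gmul (Dl x g) (Dl x h) = Dl x (g * h).
Proof.
apply: Geq => y //=. rewrite finv_id /delta. case: excluded_middle_informative => // _. exact: mulg1.
Qed.

Lemma Dl_e x : Dl x e = oneG.
Proof. apply: Geq => y //=. rewrite /delta. by case: excluded_middle_informative. Qed.

Lemma Dl_comm x y g h : x <> y -> Gmul (Dl x g) (Dl y h) = Gmul (Dl y h) (Dl x g).
Proof.
move=> ne. apply: Geq => t //=. rewrite finv_id /delta.
case: excluded_middle_informative => [->|_].
  case: excluded_middle_informative => // _. by rewrite mul1g mulg1.
by rewrite mul1g mulg1.
Qed.

Lemma Dl_conj (a : Cantor -> T) v x g : bij v ->
  Gmul (a, v) (Dl x g) = Gmul (Dl (v x) (a (v x) * (g * inv (a (v x))))) (a, v).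
Proof.
move=> B. apply: Geq => y //=. rewrite finv_id.
case: (excluded_middle_informative (y = v x)) => [->|ne].
  by rewrite finv_l // !delta_eq; gsimp.
rewrite !delta_ne // ?mulg1 ?mul1g // => E. apply: ne. by rewrite -E finv_r.
Qed.

Lemma Dl_conjV v x g : bij v -> Gmul (Vl v) (Dl x g) = Gmul (Dl (v x) g) (Vl v).
Proof. move=> B. by rewrite /Vl Dl_conj // inv1 mulg1 mul1g. Qed.

Lemma Vl_mul v w : Gmul (Vl v) (Vl w) = Vl (fun x => v (w x)).
Proof. apply: Geq => x //=. exact: mul1g. Qed.

Lemma G_decomp a v : (a, v) = Gmul (a, fun x => x) (Vl v).
Proof. apply: Geq => x //=. by rewrite mulg1. Qed.

Lemma K_cons x g a : Gmul (Dl x g) (a, fun y => y) = (pmul Gm (delta x g) a, fun y => y).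
Proof. apply: Geq => y //=. by rewrite finv_id. Qed.

Lemma K_ind (P : (Cantor -> T) -> Prop) : P (fun _ => e) ->
  (forall x g a, inQ2 x -> inK Gm a -> P a -> P (pmul Gm (delta x g) a)) ->
  forall a, inK Gm a -> P a.
Proof.
move=> P1 PM a [Ka [l Hl]]. elim: l a Ka Hl => [|x l IH] a Ka Hl.
  have -> // : a = fun _ => e. extensionality x. apply: NNPP. exact: Hl.
q2case x => [Hx|N]; last first.
  apply: IH => // y ne. case: (Hl y ne) => // E. case: ne. by rewrite -E Ka.
pose a' y := if excluded_middle_informative (y = x) then e else a y.
have -> : a = pmul Gm (delta x (a x)) a'.
  extensionality y. rewrite /pmul /a' /delta.
  case: excluded_middle_informative => [->|ne]; by rewrite ?mulg1 ?mul1g.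
have Ka' : inKbar Gm a' by move=> y N; rewrite /a'; case: excluded_middle_informative => // _; apply: Ka.
have Hl' y : a' y <> e -> In y l.
  rewrite /a'. case: excluded_middle_informative => // ne /Hl [E|//]. by case: ne.
apply: PM => //; first by split=> //; exists l.
exact: IH.
Qed.

Lemma inG_K a : inK Gm a -> inG (a, fun x => x).
Proof. move=> H. split=> //. exact: isV_id. Qed.

Lemma aut_ext al be : isAutG al -> isAutG be ->
  (forall x g, inQ2 x -> al (Dl x g) = be (Dl x g)) ->
  (forall v, isV v -> al (Vl v) = be (Vl v)) -> forall g, inG g -> al g = be g.
Proof.
move=> Aa Ab ED EV. case=> [a v] [/= Ha Hv]. rewrite G_decomp.
have HV := inG_Vl _ Hv. have HK := inG_K _ Ha.
case: (Aa) => _ [-> // _]. case: (Ab) => _ [-> // _]. rewrite EV //. f_equal.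
move: a Ha {HK}. apply: K_ind; first by rewrite -/oneG !aut_one.
move=> x g a Hx Ha E. rewrite -K_cons. have HK := inG_K _ Ha. have HD := inG_Dl x g Hx.
case: (Aa) => _ [-> // _]. case: (Ab) => _ [-> // _]. by rewrite ED // E.
Qed.

Lemma aut_inverse al : isAutG al -> exists al', isAutG al' /\
  (forall g, inG g -> al' (al g) = g) /\ (forall g, inG g -> al (al' g) = g).
Proof.
move=> [A1 [A2 [A3 A4]]].
pose al' h := epsilon (inhabits oneG) (fun g => inG g /\ al g = h).
have R h : inG h -> inG (al' h) /\ al (al' h) = h.
  move=> Hh. exact: (epsilon_spec (inhabits oneG) _ (A4 h Hh)).
have L g : inG g -> al' (al g) = g.
  move=> Hg. have [H E] := R _ (A1 _ Hg). exact: A3.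
exists al'. split; last by split=> // g /R [].
split; [|split; [|split]].
- by move=> g /R [].
- move=> g h Hg Hh. have [H1 E1] := R g Hg. have [H2 E2] := R h Hh.
  have [H3 E3] := R _ (inG_mul _ _ Hg Hh). apply: A3 => //; first exact: inG_mul.
  by rewrite E3 A2 // E1 E2.
- move=> g h Hg Hh E. have [_ E1] := R g Hg. have [_ E2] := R h Hh. by rewrite -E1 E E2.
- move=> h Hh. exists (al h). split; [exact: A1|exact: L].
Qed.

(** * Automorphisms preserve the base group *)

Section Aut.
Variable al : G -> G.
Hypothesis Aal : isAutG al.

Lemma al_in g : inG g -> inG (al g). Proof. by case: Aal => H _; apply: H. Qed.
Lemma al_mul g h : inG g -> inG h -> al (Gmul g h) = Gmul (al g) (al h).
Proof. by case: Aal => _ [H _]; apply: H. Qed.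
Lemma al_inj g h : inG g -> inG h -> al g = al h -> g = h.
Proof. by case: Aal => _ [_ [H _]]; apply: H. Qed.
Lemma al_surj h : inG h -> exists g, inG g /\ al g = h.
Proof. by case: Aal => _ [_ [_ H]]; apply: H. Qed.

Lemma snd_al_mul g h t : inG g -> inG h -> snd (al (Gmul g h)) t = snd (al g) (snd (al h) t).
Proof. move=> Hg Hh. by rewrite al_mul. Qed.

Lemma snd_al_conj a v x h : inG (a, v) -> inQ2 x ->
  (fun t => snd (al (a, v)) (snd (al (Dl x h)) (finv (snd (al (a, v))) t))) =
  snd (al (Dl (v x) (a (v x) * (h * inv (a (v x)))))).
Proof.
move=> Hg Hx. have [_ Hv] := Hg. have Hvx := proj1 (inQ2_isV _ _ Hv) Hx.
have B : bij (snd (al (a, v))) by case: (al_in _ Hg) => _; apply: isV_bij.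
extensionality t. have E := Dl_conj a v x h (isV_bij _ Hv).
rewrite -snd_al_mul //; first exact: inG_Dl.
rewrite E snd_al_mul //; first exact: inG_Dl. by rewrite finv_r.
Qed.

Lemma aut_base a : inK Gm a -> snd (al (a, fun x => x)) = (fun x => x).
Proof.
have T0 x v : inQ2 x -> (inQ2 x /\ exists g, v = snd (al (Dl x g))) -> v = (fun t => t).
{ move: x v. apply: (family_trivial (fun x v => inQ2 x /\ exists g, v = snd (al (Dl x g)))).
  - move=> x v [Hx [g ->]]. by case: (al_in _ (inG_Dl x g Hx)).
  - move=> x v w [Hx [g ->]] [_ [h ->]]. split=> //. exists (g * h).
    extensionality t. rewrite -Dl_mul snd_al_mul; [exact: inG_Dl|exact: inG_Dl|done].
  - move=> x v [Hx [g ->]]. split=> //. exists (inv g).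
    have Hg := inG_Dl x g Hx. have Hg' := inG_Dl x (inv g) Hx.
    by apply: finv_uniq => t; rewrite -snd_al_mul // Dl_mul ?mulgV ?mulVg Dl_e aut_one.
  - move=> x y v w Hx Hy ne [_ [g ->]] [_ [h ->]] t.
    have Hg := inG_Dl x g Hx. have Hh := inG_Dl y h Hy.
    by rewrite -!snd_al_mul // Dl_comm.
  (* A preimage of [w] may have a nontrivial base part, but that part only conjugates the element of
     Gamma: the index still moves from [x] to [v x]. *)
  - move=> w x Hw Hx. have [[a' v] [Hg E]] := al_surj _ (inG_Vl _ Hw).
    have Hvx := proj1 (inQ2_isV _ _ (proj2 Hg)) Hx.
    exists (v x). split=> // u [_ [h ->]]. split=> //.
    exists (a' (v x) * (h * inv (a' (v x)))). by rewrite -(snd_al_conj a' v x h Hg Hx) E.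
  - move=> x y u Hx Hy [_ [h ->]]. have [v [Hv Ev]] := isV_transitive _ _ Hx Hy.
    exists (snd (al (Vl v))). split; first by case: (al_in _ (inG_Vl _ Hv)).
    split=> //. eexists. rewrite -Ev. exact: (snd_al_conj (fun _ => e) v x h (inG_Vl _ Hv) Hx). }
move: a. apply: K_ind; first by rewrite -/oneG aut_one.
move=> x g a Hx Ha E. rewrite -K_cons. extensionality t.
rewrite snd_al_mul; [exact: inG_Dl|exact: inG_K|]. rewrite E.
by rewrite (T0 x (snd (al (Dl x g))) Hx) //; split=> //; exists g.
Qed.

Definition psi v := snd (al (Vl v)).

Lemma snd_al a v : inG (a, v) -> snd (al (a, v)) = psi v.
Proof.
move=> [Ha Hv]. rewrite G_decomp. extensionality t.
rewrite snd_al_mul; [exact: inG_K|exact: inG_Vl|]. by rewrite aut_base.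
Qed.

Lemma al_Dl_snd x g : inQ2 x -> snd (al (Dl x g)) = (fun t => t).
Proof. move=> Hx. apply: aut_base. by case: (inG_Dl x g Hx). Qed.

Lemma isV_psi v : isV v -> isV (psi v).
Proof. move=> H. by case: (al_in _ (inG_Vl _ H)). Qed.

Lemma psi_surj w : isV w -> exists v, isV v /\ psi v = w.
Proof.
move=> Hw. have [[a v] [Hg E]] := al_surj _ (inG_Vl _ Hw).
exists v. split; first exact: (proj2 Hg). by rewrite -(snd_al a) // E.
Qed.

Lemma al_equivariant v x g y : isV v -> inQ2 x ->
  fst (al (Vl v)) (psi v y) * fst (al (Dl x g)) y =
  fst (al (Dl (v x) g)) (psi v y) * fst (al (Vl v)) (psi v y).
Proof.
move=> Hv Hx. have Hvx := proj1 (inQ2_isV _ _ Hv) Hx.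
have := f_equal al (Dl_conjV v x g (isV_bij _ Hv)).
rewrite !al_mul; try exact: inG_Vl; try exact: inG_Dl.
move/(f_equal (fun k => fst k (psi v y))). rewrite /= al_Dl_snd // finv_id.
rewrite -/(psi v) finv_l //. by apply: isV_bij; apply: isV_psi.
Qed.

(** The base part of [al (Vl v)] only conjugates values, so it does not affect whether they are
    trivial. *)
Lemma al_support_equivariant v x g y : isV v -> inQ2 x ->
  fst (al (Dl (v x) g)) (psi v y) <> e <-> fst (al (Dl x g)) y <> e.
Proof.
move=> Hv Hx. have E := al_equivariant v x g y Hv Hx. split=> N E'; apply: N; rewrite E' in E.
  by move: E; rewrite mulg1 -{1}(mul1g (fst _ _)) => /(mulIg _ HGm).
by move: E; rewrite mul1g -{2}(mulg1 (fst _ _)) => /(mulgI _ HGm).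
Qed.

Lemma al_support_ne x g : inQ2 x -> g <> e -> exists y, fst (al (Dl x g)) y <> e.
Proof.
move=> Hx ne. apply: NNPP => N. apply: ne.
have E : al (Dl x g) = al oneG.
  rewrite aut_one //. apply: Geq => y; last by rewrite al_Dl_snd.
  apply: NNPP => N'. apply: N. by exists y.
move/al_inj: E => /(_ (inG_Dl x g Hx) inG_one) /(f_equal (fun k => fst k x)).
by rewrite /= delta_eq.
Qed.

Lemma al_support_singleton x g h y y' : inQ2 x -> g <> e -> h <> e ->
  fst (al (Dl x g)) y <> e -> fst (al (Dl x h)) y' <> e -> y = y'.
Proof.
move=> Hx Ng Nh.
apply: (supports_singleton {g : T | g <> e} (fun x i y => fst (al (Dl x (proj1_sig i))) y <> e) psi
  _ _ _ psi_surj _ x (exist _ g Ng) (exist _ h Nh)) => //.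
- move=> t i Ht. by case: (al_in _ (inG_Dl t (proj1_sig i) Ht)) => -[_].
- move=> t i u Ht ne. apply: NNPP => N. apply: ne.
  case: (al_in _ (inG_Dl t (proj1_sig i) Ht)) => -[K _] _. exact: K.
- move=> t [i Hi] Ht. exact: al_support_ne.
- move=> v t i u. exact: al_support_equivariant.
Qed.

Lemma al_spatial : (exists g : T, g <> e) -> exists f0,
  (forall x, inQ2 x -> inQ2 (f0 x)) /\
  (forall x g y, inQ2 x -> g <> e -> (fst (al (Dl x g)) y <> e <-> y = f0 x)) /\
  (forall v x, isV v -> inQ2 x -> f0 (v x) = psi v (f0 x)).
Proof.
move=> [g0 N0].
pose f0 x := epsilon (inhabits x) (fun y => fst (al (Dl x g0)) y <> e).
have H0 x : inQ2 x -> fst (al (Dl x g0)) (f0 x) <> e.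
  move=> Hx. exact: (epsilon_spec (inhabits x) _ (al_support_ne x g0 Hx N0)).
have HF x g y : inQ2 x -> g <> e -> (fst (al (Dl x g)) y <> e <-> y = f0 x).
  move=> Hx Ng. split=> [N|->].
    exact: (al_support_singleton x g g0 y (f0 x) Hx Ng N0 N (H0 x Hx)).
  have [y' N'] := al_support_ne x g Hx Ng.
  by rewrite -(al_support_singleton x g g0 y' (f0 x) Hx Ng N0 N' (H0 x Hx)).
exists f0. split; [|split=> //].
- move=> x Hx. apply: NNPP => N. apply: (H0 x Hx).
  case: (al_in _ (inG_Dl x g0 Hx)) => -[K _] _. exact: K.
- move=> v x Hv Hx. symmetry. apply/HF; [exact: (proj1 (inQ2_isV _ _ Hv) Hx)|exact: N0|].
  apply/al_support_equivariant => //. exact: H0.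
Qed.

Lemma al_Dl_form x g y : inQ2 x -> (forall t, fst (al (Dl x g)) t <> e -> t = y) ->
  al (Dl x g) = Dl y (fst (al (Dl x g)) y).
Proof.
move=> Hx H. apply: Geq => t; last by rewrite al_Dl_snd.
case: (excluded_middle_informative (t = y)) => [->|ne]; first by rewrite /= delta_eq.
rewrite /= delta_ne //. apply: NNPP => N. exact: ne (H t N).
Qed.

End Aut.

(** * The homeomorphism induced by an automorphism *)

Lemma isAutGamma_id : isAutGamma Gm (fun h => h).
Proof. split=> //. split=> // y. by exists y. Qed.

(** The inverse automorphism is treated in parallel: its point map [f1] inverts [f0], both are
    uniformly continuous, and density of the dyadic points makes the two extensions inverse to each
    other. *)
Lemma al_homeo al : (exists g : T, g <> e) -> isAutG al -> exists phi, inStab phi /\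
  (forall v x, isV v -> psi al v (phi x) = phi (v x)) /\
  (forall x g, inQ2 x -> exists h, al (Dl x g) = Dl (phi x) h).
Proof.
move=> NT A. have [al' [A' [L R]]] := aut_inverse al A.
have [f0 [Q [F E]]] := al_spatial al A NT. have [f1 [Q' [F' E']]] := al_spatial al' A' NT.
have inverse be be' fb fb' : isAutG be -> (forall g, inG g -> be' (be g) = g) ->
    (forall x, inQ2 x -> inQ2 (fb x)) ->
    (forall x g y, inQ2 x -> g <> e -> (fst (be (Dl x g)) y <> e <-> y = fb x)) ->
    (forall x g y, inQ2 x -> g <> e -> (fst (be' (Dl x g)) y <> e <-> y = fb' x)) ->
    forall x, inQ2 x -> fb' (fb x) = x.
  move=> Ab Lb Qb Fb Fb' x Hx. case: NT => g Ng.
  have Ed := al_Dl_form be Ab x g (fb x) Hx (fun t => proj1 (Fb x g t Hx Ng)).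
  have Nh : fst (be (Dl x g)) (fb x) <> e by apply/Fb.
  symmetry. apply/(Fb' _ _ _ (Qb x Hx) Nh). rewrite -Ed Lb; first exact: inG_Dl.
  by rewrite /= delta_eq.
have I x : inQ2 x -> f1 (f0 x) = x by exact: (inverse al al' f0 f1 A L Q F F').
have I' x : inQ2 x -> f0 (f1 x) = x by exact: (inverse al' al f1 f0 A' R Q' F' F).
have unif be fb fb' : isAutG be -> (forall x, inQ2 x -> inQ2 (fb x)) ->
    (forall v x, isV v -> inQ2 x -> fb (v x) = psi be v (fb x)) ->
    (forall x, inQ2 x -> fb' (fb x) = x) -> unif_Q2 fb.
  move=> Ab Qb Eb Ib. apply: equivariant_unif => // [x y Hx Hy Exy|s Hs].
    by rewrite -(Ib x) // Exy Ib.
  have [t [Ht Et]] := psi_surj be Ab s Hs. exists t. split=> // q Hq. by rewrite Eb // Et.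
have [phi [C Ephi]] := unif_extend _ (unif al f0 f1 A Q E I).
have [phi' [C' Ephi']] := unif_extend _ (unif al' f1 f0 A' Q' E' I').
have K x : phi' (phi x) = x.
  apply: (f_equal (fun g => g x) (cont_dense (fun x => phi' (phi x)) (fun x => x) _ contC_id _)).
    exact: contC_comp.
  move=> q Hq. by rewrite Ephi // Ephi' ?I //; apply: Q.
have K' x : phi (phi' x) = x.
  apply: (f_equal (fun g => g x) (cont_dense (fun x => phi (phi' x)) (fun x => x) _ contC_id _)).
    exact: contC_comp.
  move=> q Hq. by rewrite Ephi' // Ephi ?I' //; apply: Q'.
have Eq v x : isV v -> psi al v (phi x) = phi (v x).
  move=> Hv. have Cv := isV_cont _ Hv. have Cp := isV_cont _ (isV_psi al A v Hv).
  apply: (f_equal (fun g => g x) (cont_dense (fun x => psi al v (phi x)) (fun x => phi (v x)) _ _ _));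
    [exact: contC_comp|exact: contC_comp|].
  move=> q Hq. rewrite !Ephi ?E //. exact: (proj1 (inQ2_isV _ _ Hv) Hq).
have Ef : finv phi = phi' by apply: finv_uniq.
exists phi. split; [|split] => //.
- split; first by split=> //; exists phi'.
  split; [|split].
  + move=> v Hv. rewrite Ef. have -> : (fun x => phi (v (phi' x))) = psi al v.
      extensionality x. by rewrite -Eq // K'.
    exact: isV_psi.
  + move=> w Hw. have [v [Hv Ev]] := psi_surj al A w Hw. exists v. split=> // x.
    by rewrite Ef -Eq // K' Ev.
  + move=> x. split=> Hx; first by rewrite Ephi //; apply: Q.
    rewrite -(K x) Ephi' //. exact: Q'.
- move=> x g Hx. exists (fst (al (Dl x g)) (phi x)). apply: al_Dl_form => // t N.
  case: (excluded_middle_informative (g = e)) => [Eg|Ng].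
    by case: N; rewrite Eg Dl_e aut_one.
  rewrite Ephi //. exact: (proj1 (F x g t Hx Ng) N).
Qed.

(** * Values of Xi on generators *)

Lemma Aphib_Dl phi b x g : bij phi -> isAutGamma Gm b ->
  Aphib Gm phi b (Dl x g) = Dl (phi x) (b g).
Proof.
move=> B A. apply: Geq => y /=; last by rewrite finv_r.
case: (excluded_middle_informative (y = phi x)) => [->|ne]; first by rewrite finv_l // !delta_eq.
rewrite !delta_ne // ?(aut1 _ HGm) // => E. apply: ne. by rewrite -E finv_r.
Qed.

Lemma Xi_Dl z f phi b x g : bij phi -> isAutGamma Gm b -> inQ2 (phi x) ->
  Xi Gm (z, f, phi, b) (Dl x g) = Dl (phi x) (f (phi x) * (b g * inv (f (phi x)))).
Proof.
move=> B A Hx. rewrite /Xi Aphib_Dl //. apply: Geq => y; last by rewrite Ez_snd ad_snd.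
rewrite Ez_fst ad_snd ad_fst; first exact: isV_id. rewrite /= finv_id.
have -> : restrictQ2 Gm (fun x0 => zpow Gm z (p_v (fun y0 => y0) x0)) y = e.
  rewrite /restrictQ2. case: excluded_middle_informative => // _. by rewrite p_v_id.
case: (excluded_middle_informative (y = phi x)) => [->|ne].
  by rewrite !delta_eq mulg1.
by rewrite !delta_ne //; gsimp.
Qed.

Lemma Xi_Vl z f phi b v x : inStab phi -> isAutGamma Gm b -> isV v ->
  fst (Xi Gm (z, f, phi, b) (Vl v)) x =
  f x * inv (f (finv (fun y => phi (v (finv phi y))) x)) *
  restrictQ2 Gm (fun y => zpow Gm z (p_v (fun y => phi (v (finv phi y))) y)) x.
Proof.
move=> S A Hv. rewrite /Xi Ez_fst ad_snd ad_fst; first exact: stab_conj_isV.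
by rewrite Aphib_fst Aphib_snd /= (aut1 _ HGm) // mul1g.
Qed.

Lemma Xi_snd q g : snd (Xi Gm q g) = snd (Aphib Gm (snd (fst q)) (snd q) g).
Proof. case: q => [[[z f] phi] b]. by rewrite /Xi Ez_snd ad_snd. Qed.

(** * Automorphisms acting trivially on the dyadic points *)

Section Normalised.
Variable al : G -> G.
Hypothesis Aal : isAutG al.
Hypothesis al_Dl : forall x g, inQ2 x -> exists h, al (Dl x g) = Dl x h.
Hypothesis al_Vl : forall v, isV v -> psi al v = v.

Let c v x := fst (al (Vl v)) x.
Let beta x g := fst (al (Dl x g)) x.

Lemma norm_Dl x g : inQ2 x -> al (Dl x g) = Dl x (beta x g).
Proof. move=> Hx. rewrite /beta. have [h ->] := al_Dl x g Hx. by rewrite /= delta_eq. Qed.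

Lemma norm_c_comp v w x : isV v -> isV w -> c (fun y => v (w y)) x = c v x * c w (finv v x).
Proof.
move=> Hv Hw. rewrite /c -Vl_mul (al_mul al Aal); [exact: inG_Vl|exact: inG_Vl|].
by rewrite /= -/(psi al v) al_Vl.
Qed.

Lemma norm_beta_c v x g : isV v -> inQ2 x ->
  c v (v x) * beta x g = beta (v x) g * c v (v x).
Proof. move=> Hv Hx. have := al_equivariant al Aal v x g x Hv Hx. by rewrite al_Vl. Qed.

Lemma norm_beta_mul x g h : inQ2 x -> beta x (g * h) = beta x g * beta x h.
Proof.
move=> Hx. rewrite {1}/beta -Dl_mul (al_mul al Aal); [exact: inG_Dl|exact: inG_Dl|].
by rewrite /= al_Dl_snd // finv_id.
Qed.

Lemma norm_K a x : inK Gm a -> inQ2 x -> fst (al (a, fun y => y)) x = beta x (a x).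
Proof.
move=> Ha Hx. have b1 : beta x e = e by rewrite /beta Dl_e aut_one.
move: a Ha. apply: K_ind; first by rewrite -/oneG aut_one.
move=> y g a Hy Ha E. rewrite -K_cons (al_mul al Aal); [exact: inG_Dl|exact: inG_K|].
rewrite /= al_Dl_snd // finv_id E /pmul norm_beta_mul // norm_Dl //=. f_equal.
case: (excluded_middle_informative (x = y)) => [->|ne]; first by rewrite !delta_eq.
by rewrite !delta_ne.
Qed.

Lemma norm_beta_aut : isAutGamma Gm (beta zeroC).
Proof.
have H0 := inQ2_zero. split; first by move=> g h; apply: norm_beta_mul. split.
  move=> g h E. have : Dl zeroC g = Dl zeroC h.
    by apply: (al_inj al Aal); rewrite ?norm_Dl ?E //; apply: inG_Dl.
  move/(f_equal (fun k => fst k zeroC)). by rewrite /= !delta_eq.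
move=> h. have [[a v] [Hg E]] := al_surj al Aal _ (inG_Dl zeroC h H0).
(* [al] induces the identity on V, so a preimage of a base element is again in the base group. *)
have Ev : v = (fun x => x).
  have := snd_al al Aal a v Hg. rewrite al_Vl; first exact: (proj2 Hg). by rewrite E.
exists (a zeroC). subst v. have [/= Ha _] := Hg. by rewrite -norm_K // E /= delta_eq.
Qed.

(** When [s] fixes 0, both sides of [norm_beta_c] involve the same [beta zeroC], so [c s zeroC]
    commutes with its image, which is all of Gamma. *)
Lemma norm_central s : stab0 s -> central Gm (c s zeroC).
Proof.
move=> [Hs Es] h. have [g <-] := proj2 (proj2 norm_beta_aut) h.
have := norm_beta_c s zeroC g Hs inQ2_zero. by rewrite Es.
Qed.

Let zeta := c g0 zeroC.

Lemma norm_slope s : stab0 s -> c s zeroC = zpow Gm zeta (lslope s zeroC).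
Proof.
have M v w : stab0 v -> stab0 w -> c (fun x => v (w x)) zeroC = c v zeroC * c w zeroC.
  move=> Sv Sw. rewrite norm_c_comp; [exact: (proj1 Sv)|exact: (proj1 Sw)|].
  by rewrite (proj2 (stab0_finv _ Sv)).
apply: (stab_hom_pow Gm HGm (fun s => c s zeroC)) => //.
apply: (stab_hom_kill Gm HGm (fun s => c s zeroC)) => // v w Sv Sw. exact: norm_central.
Qed.

Let vx x := epsilon (inhabits (fun y : Cantor => y)) (fun v => isV v /\ v zeroC = x).
(** Replacing [vx x] by [vx x] followed after some [s] fixing 0 multiplies [c] by [zeta] to the
    log-slope of [s] and adds that log-slope to [p_v]; the quotient is therefore independent of the
    choice. *)
Let f := restrictQ2 Gm (fun x => c (vx x) x * inv (zpow Gm zeta (p_v (vx x) x))).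

Lemma norm_vx x : inQ2 x -> isV (vx x) /\ vx x zeroC = x.
Proof.
move=> Hx. exact: (epsilon_spec (inhabits (fun y : Cantor => y)) _ (isV_transitive _ _ inQ2_zero Hx)).
Qed.

Lemma norm_zeta_central : central Gm zeta.
Proof. apply: norm_central. exact: stab0_g0. Qed.

(** Up to the central cocycle of [zeta], [c] is the coboundary of [f]. With [y = v^-1 x], both
    [v (vx y)] and [vx x] send 0 to [x], so they differ by some [s] fixing 0, to which [norm_slope]
    applies. *)
Lemma norm_key v x : isV v -> inQ2 x -> c v x * f (finv v x) = f x * zpow Gm zeta (p_v v x).
Proof.
move=> Hv Hx. have Hy := inQ2_finv _ _ Hv Hx. set y := finv v x in Hy *.
have [Hvx Ex] := norm_vx x Hx. have [Hvy Ey] := norm_vx y Hy.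
have Bx := isV_bij _ Hvx.
pose s t := finv (vx x) (v (vx y t)).
have Hvvy := isV_comp _ _ Hv Hvy.
have Ss : stab0 s.
  split; first exact: (isV_comp (finv (vx x)) _ (isV_finv _ Hvx) Hvvy).
  rewrite /s Ey finv_r; first exact: isV_bij. exact: finv_eq.
have Evs : (fun t => v (vx y t)) = (fun t => vx x (s t)).
  by extensionality t; rewrite /s finv_r.
have E0 : finv (vx x) x = zeroC by apply: finv_eq.
have Ec : c v x * c (vx y) y = c (vx x) x * zpow Gm zeta (lslope s zeroC).
  have E1 := norm_c_comp (vx x) s x Hvx (proj1 Ss). rewrite E0 norm_slope // in E1.
  by rewrite -E1 -Evs (norm_c_comp v (vx y)).
have Ep : (p_v v x + p_v (vx y) y = p_v (vx x) x + lslope s zeroC)%Z.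
  rewrite -p_v_fixed; [exact: (proj1 Ss)|exact: (proj2 Ss)|].
  have E1 := p_v_comp (vx x) s x Hvx (proj1 Ss). rewrite E0 in E1.
  by rewrite -E1 -Evs (p_v_comp v (vx y)).
rewrite /f !rq_in // mulA Ec -!mulA. f_equal. rewrite -!(zpow_opp _ HGm) -!(zpow_add _ HGm).
f_equal. lia.
Qed.

Lemma norm_beta x g : inQ2 x -> beta x g = f x * (beta zeroC g * inv (f x)).
Proof.
move=> Hx. have [Hvx Ex] := norm_vx x Hx.
have := norm_beta_c (vx x) zeroC g Hvx inQ2_zero. rewrite Ex => E.
rewrite /f rq_in //. set k := zpow _ _ _.
have Ck : central Gm k by apply: central_zpow => //; exact: norm_zeta_central.
gsimp. rewrite (mulA (beta zeroC g) k) -(Ck (beta zeroC g)) -!mulA mulKg mulA E.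
by gsimp.
Qed.

(** By [norm_key], [f] agrees with its translate by [v] wherever [c v] and [p_v v] are both trivial,
    hence off a finite set; so conjugation by [f] and by its inverse preserve finite support. *)
Lemma norm_f_inNKG : inNKG Gm f.
Proof.
have Kf : inKbar Gm f by move=> x N; apply: rq_out.
have fin v : isV v -> exists l, forall x, f x <> f (finv v x) -> In x l.
  move=> Hv. have [[Kc [lc Hc]] _] := al_in al Aal _ (inG_Vl v Hv).
  have [lp Hp] := p_v_finite v Hv. exists (lc ++ lp) => x ne. apply/in_app_iff.
  q2case x => [Hx|N]; last by case: ne; rewrite !Kf //; apply: notQ2_finv.
  case: (excluded_middle_informative (c v x = e)) => [Ec|/Hc]; last by left.
  right. apply: Hp => // Ep. apply: ne. have := norm_key v x Hv Hx.
  by rewrite Ec Ep /= mul1g mulg1.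
split=> //. split.
- case=> [a v] [[/= Ka [la Ha]] Hv]. split; last by rewrite ad_snd.
  have [l Hl] := fin v Hv. split=> [x N|].
    by rewrite ad_fst //= Ka // !Kf ?inv1 ?mul1g //; apply: notQ2_finv.
  exists (la ++ l) => x. rewrite ad_fst //= => ne. apply/in_app_iff.
  case: (excluded_middle_informative (a x = e)) => [E|/Ha]; last by left.
  right. apply: Hl => E'. apply: ne. by rewrite E -E' mul1g mulgV.
- case=> [a v] [[/= Ka [la Ha]] Hv].
  exists (fun x => inv (f x) * (a x * f (finv v x)), v). split.
    split=> //=. have [l Hl] := fin v Hv. split=> [x N|].
      by rewrite Ka // !Kf ?inv1 ?mul1g //; apply: notQ2_finv.
    exists (la ++ l) => x ne. apply/in_app_iff.
    case: (excluded_middle_informative (a x = e)) => [E|/Ha]; last by left.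
    right. apply: Hl => E'. apply: ne. by rewrite E -E' mul1g mulVg.
  apply: Geq => x; last by rewrite ad_snd. rewrite ad_fst //=. by gsimp.
Qed.

Lemma normalised_aut : exists z f b, central Gm z /\ inNKG Gm f /\ isAutGamma Gm b /\
  forall g, inG g -> Xi Gm (z, f, fun x => x, b) g = al g.
Proof.
have Sid := inStab_isV _ isV_id.
exists zeta, f, (beta zeroC). split; first exact: norm_zeta_central.
split; first exact: norm_f_inNKG. split; first exact: norm_beta_aut.
apply: aut_ext => //.
- apply: Xi_aut. by split; [exact: norm_zeta_central|split; [exact: norm_f_inNKG|split=> //; exact: norm_beta_aut]].
- move=> x g Hx. rewrite Xi_Dl //; [exact: bij_id|exact: norm_beta_aut|].
  by rewrite norm_Dl // (norm_beta x).
- move=> v Hv. apply: Geq => x.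
    rewrite Xi_Vl //; first exact: norm_beta_aut. rewrite finv_id -/(c v x).
    q2case x => [Hx|N].
      rewrite rq_in //. have E := norm_key v x Hv Hx.
      apply: (mulIg _ HGm (f (finv v x))). rewrite E.
      rewrite -!mulA -(central_zpow _ HGm _ _ norm_zeta_central (f x)).
      rewrite (mulA (inv _)) -(central_zpow _ HGm _ _ norm_zeta_central (inv _)) -!mulA mulVg mulg1.
      by rewrite (central_zpow _ HGm _ _ norm_zeta_central).
    have [[Kc _] _] := al_in al Aal _ (inG_Vl v Hv).
    have Kf : inKbar Gm f := proj1 norm_f_inNKG.
    rewrite rq_out // /c Kc // !Kf //; first exact: notQ2_finv. by gsimp.
  by rewrite Xi_snd /= finv_id -/(psi al v) al_Vl.
Qed.
End Normalised.

(** * Surjectivity and kernel *)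

Lemma Xi_surj al : (exists g : T, g <> e) -> isAutG al ->
  exists q, inQ Gm q /\ forall g, inG g -> Xi Gm q g = al g.
Proof.
move=> NT A. have [phi [S [Eq FD]]] := al_homeo al NT A. have B := stab_bij _ S.
have S' := inStab_finv _ S. have B' := finv_bij _ B. have Aid := isAutGamma_id.
pose al1 g := al (Aphib Gm (finv phi) (fun h => h) g).
have A1 : isAutG al1 by apply: isAutG_comp => //; apply: Aphib_aut.
have [|v Hv|z [f [b [Cz [Nf [Ab E]]]]]] := normalised_aut al1 A1.
- move=> x g Hx. rewrite /al1 Aphib_Dl //.
  have [h ->] := FD (finv phi x) g (proj1 (stab_inQ2_finv _ S _) Hx).
  exists h. by rewrite finv_r.
- rewrite /psi /al1. have -> : Aphib Gm (finv phi) (fun h => h) (Vl v) = Vl (conjV phi v).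
    apply: Geq => x //=. by rewrite finv_finv.
  rewrite -/(psi al (conjV phi v)). extensionality x.
  rewrite -{1}(finv_r phi x B) Eq; first exact: stab_conjV_isV. by rewrite /conjV !finv_r.
- exists (z, f, phi, b). split; first by [].
  move=> g Hg. have := E _ (Aphib_inG phi (fun h => h) g S Aid Hg).
  rewrite /al1 /Xi !Aphib_comp //; first exact: bij_id. move=> ->. f_equal.
  have -> : (fun x => finv phi (phi x)) = (fun x => x) by extensionality x; exact: finv_l.
  by apply: Geq => x /=; rewrite finv_id.
Qed.

(** A nontrivial point mass at each dyadic point forces [phi] to be the identity; [g0], of log-slope
    1 at its fixed point 0, forces [z = e]; transitivity of V then makes [f] constant, and [b]
    undoes conjugation by that constant. *)
Lemma Xi_kernel q : (exists g : T, g <> e) -> inQ Gm q ->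
  ((forall g, inG g -> Xi Gm q g = g) <-> exists g1 : T, Qeq Gm q (kerElt Gm g1)).
Proof.
case: q => [[[z f] phi] b] NT [Cz [Nf [S A]]]. have B := stab_bij _ S. split.
- move=> K. case: NT => g1 N1.
  have D x g : inQ2 x -> Dl (phi x) (f (phi x) * (b g * inv (f (phi x)))) = Dl x g.
    move=> Hx. rewrite -(Xi_Dl z) //; first exact: (proj1 (stab_inQ2 _ S _) Hx).
    apply: K. exact: inG_Dl.
  have Ephi : phi = (fun x => x).
    apply: cont_dense; [exact: (proj1 (proj1 S))|exact: contC_id|].
    move=> x Hx. apply: NNPP => N. apply: N1.
    have := f_equal (fun k => fst k x) (D x g1 Hx). rewrite /= delta_eq delta_ne //.
    by move=> E; apply: N.
  subst phi.
  have Hb x g : inQ2 x -> f x * (b g * inv (f x)) = g.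
    move=> Hx. have := f_equal (fun k => fst k x) (D x g Hx). by rewrite /= !delta_eq.
  have HV v x : isV v -> inQ2 x -> f x * inv (f (finv v x)) * zpow Gm z (p_v v x) = e.
    move=> Hv Hx. have := f_equal (fun k => fst k x) (K _ (inG_Vl v Hv)).
    by rewrite Xi_Vl // finv_id rq_in.
  have Ez1 : z = e.
    have := HV g0 zeroC isV_g0 inQ2_zero. rewrite p_v_fixed; [exact: isV_g0|exact: g0_zero|].
    rewrite lslope_g0 zpow_1 //. have -> : finv g0 zeroC = zeroC.
      by apply: finv_eq; [exact: g0_bij|exact: g0_zero].
    by rewrite mulgV mul1g.
  have Ef x : inQ2 x -> f x = f zeroC.
    move=> Hx. have [v [Hv Ev]] := isV_transitive _ _ inQ2_zero Hx.
    have := HV v x Hv Hx. have -> : finv v x = zeroC by apply: finv_eq => //; apply: isV_bij.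
    rewrite Ez1 zpow_e // mulg1 => E. apply: (mulIg _ HGm (inv (f zeroC))). by rewrite mulgV.
  exists (f zeroC). split=> //. split; [|split=> // h].
    exists e. split; first exact: central1. extensionality x. rewrite /pmul /constQ.
    q2case x => [Hx|N]; first by rewrite !rq_in // mulg1 Ef.
    rewrite !rq_out // mulg1. by case: Nf => Kf _; rewrite Kf.
  by rewrite -{2}(Hb zeroC h inQ2_zero); gsimp.
- move=> [g1 [Ez1 [[k [Ck Ef]] [Ephi Eb]]]] g Hg.
  have E1 : phi = (fun x => x) by extensionality x. subst phi z.
  (* Equality in Q determines [f] only up to a central constant, so [k] has to be carried along and
     cancelled. *)
  have Hf x : inQ2 x -> f x = g1 * inv k.
    move=> Hx. have := f_equal (fun u => u x) Ef. rewrite /pmul /constQ !rq_in // => ->.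
    by gsimp.
  have Ck' := centralV _ HGm _ Ck.
  rewrite /Xi Ez_one. case: g Hg => [a v] [[/= Ka _] Hv].
  apply: Geq => x; last by rewrite ad_snd /= finv_id.
  rewrite ad_fst Aphib_snd finv_id // Aphib_fst finv_id /=. q2case x => [Hx|N].
    rewrite !Hf //; first exact: inQ2_finv. rewrite Eb; gsimp.
    rewrite (mulA g1 k) -(Ck g1) -!mulA mulgV mulg1 -(Ck (a x)).
    by rewrite (mulA (inv g1) k) -(Ck (inv g1)) -!mulA mulKg mulKVg.
  case: Nf => Kf _. rewrite Ka // (aut1 _ HGm b A) !Kf //; first exact: notQ2_finv. by gsimp.
Qed.

End WreathProduct.

Theorem theoremB (Gm : Grp) (HGm : group_axioms Gm)
  (Hnontriv : exists g : car Gm, g <> gone Gm) :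
  (* Xi maps Q into Aut(G) *)
  (forall q, inQ Gm q -> isAutG Gm (Xi Gm q)) /\
  (* Xi is well defined on Q (f only matters modulo Z Gamma) *)
  (forall q q', inQ Gm q -> inQ Gm q' -> Qeq Gm q q' ->
     forall g, inG Gm g -> Xi Gm q g = Xi Gm q' g) /\
  (* Xi is a group morphism *)
  (forall q1 q2, inQ Gm q1 -> inQ Gm q2 ->
     forall g, inG Gm g -> Xi Gm (Qmul Gm q1 q2) g = Xi Gm q1 (Xi Gm q2 g)) /\
  (* Xi is surjective *)
  (forall al, isAutG Gm al ->
     exists q, inQ Gm q /\ forall g, inG Gm g -> Xi Gm q g = al g) /\
  (* kernel of Xi *)
  (forall q, inQ Gm q ->
     ((forall g, inG Gm g -> Xi Gm q g = g) <->
      exists g0 : car Gm, Qeq Gm q (kerElt Gm g0))).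
Proof.
split; [|split; [|split; [|split]]].
- exact: Xi_aut.
- exact: Xi_well_defined.
- move=> q1 q2 H1 H2 g Hg. exact: Xi_mul.
- move=> al. exact: Xi_surj.
- move=> q. exact: Xi_kernel.
Qed.
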